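(* Let $\Omega\subset\mathbb{C}^d$ be a $\mathbb{C}$-proper convex open set such that $(\Omega,d_\Omega)$ is Gromov hyperbolic. Suppose $\widehat{\Omega}\subset\mathbb{C}^d$ is a $\mathbb{C}$-proper convex open set lying in the closure of the orbit $\mathrm{Aff}(\mathbb{C}^d)\Omega$ in the local Hausdorff topology (e.g. $A_n\Omega\to\widehat\Omega$ for some complex affine maps $A_n$). Then $(\widehat{\Omega},d_{\widehat{\Omega}})$ is Gromov hyperbolic.
   Context: An open convex set is $\mathbb{C}$-proper if it contains no complex affine line. $d_\Omega$ is the Kobayashi distance. $\mathrm{Aff}(\mathbb{C}^d)$ is the group of complex affine transformations of $\mathbb{C}^d$. Local Hausdorff topology: with $d_H$ the Hausdorff distance on compact sets and $B_R(0)$ the Euclidean ball, a sequence of open convex sets $A_n$ converges to an open convex set $A$ if $d_H(\overline{A_n}\cap\overline{B_R(0)},\overline{A}\cap\overline{B_R(0)})\to0$ for every $R>0$. *)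

(* Defs.v *)
From Stdlib Require Import Reals.
From Coquelicot Require Import Coquelicot.
From mathcomp Require Import ssreflect ssrfun ssrbool eqtype ssrnat fintype bigop.

Open Scope R_scope.

Definition Cd (d : nat) : Type := 'I_d -> C.

Definition cd_add {d} (x y : Cd d) : Cd d := fun i => Cplus (x i) (y i).
Definition cd_sub {d} (x y : Cd d) : Cd d := fun i => Cminus (x i) (y i).
Definition cd_scal {d} (l : C) (x : Cd d) : Cd d := fun i => Cmult l (x i).
Definition cd_zero (d : nat) : Cd d := fun _ => RtoC 0.

Definition cd_norm {d} (x : Cd d) : R :=
  sqrt (\big[Rplus/0]_(i < d) (Cmod (x i) ^ 2)).
Definition cd_dist {d} (x y : Cd d) : R := cd_norm (cd_sub x y).

Definition cd_set (d : nat) := Cd d -> Prop.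

Definition cd_open {d} (A : cd_set d) : Prop :=
  forall x, A x -> exists eps, 0 < eps /\ forall y, cd_dist x y < eps -> A y.

Definition cd_convex {d} (A : cd_set d) : Prop :=
  forall x y, A x -> A y -> forall t : R, 0 <= t <= 1 ->
    A (cd_add x (cd_scal (RtoC t) (cd_sub y x))).

Definition C_proper {d} (A : cd_set d) : Prop :=
  ~ (exists (a v : Cd d), v <> cd_zero d /\ forall l : C, A (cd_add a (cd_scal l v))).

Definition unit_disc (z : C) : Prop := Cmod z < 1.

Definition holo_disc {d} (f : C -> Cd d) : Prop :=
  forall (i : 'I_d) (z : C), unit_disc z ->
    @ex_derive C_AbsRing C_NormedModule (fun w => f w i) z.

(** Poincare distance on the unit disc: tanh^{-1}(|a-b| / |1 - conj(a) b|). *)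
Definition poincare (a b : C) : R :=
  let t := Cmod (Cminus a b) / Cmod (Cminus (RtoC 1) (Cmult (Cconj a) b)) in
  / 2 * ln ((1 + t) / (1 - t)).

Definition kob_chain {d} (A : cd_set d) (p q : Cd d) (r : R) : Prop :=
  exists (n : nat) (x : nat -> Cd d) (f : nat -> C -> Cd d) (a b : nat -> C),
    x 0%nat = p /\ x n = q /\
    (forall k, (k < n)%nat ->
       holo_disc (f k) /\ (forall z, unit_disc z -> A (f k z)) /\
       unit_disc (a k) /\ unit_disc (b k) /\
       f k (a k) = x k /\ f k (b k) = x (S k)) /\
    r = \big[Rplus/0]_(0 <= k < n) poincare (a k) (b k).

Definition kob_dist {d} (A : cd_set d) (p q : Cd d) : R :=
  real (Glb_Rbar (kob_chain A p q)).

Definition gromov_product {T} (dist : T -> T -> R) (x y w : T) : R :=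
  / 2 * (dist x w + dist y w - dist x y).

Definition gromov_hyperbolic {T} (X : T -> Prop) (dist : T -> T -> R) : Prop :=
  exists delta : R, 0 <= delta /\
    forall x y z w, X x -> X y -> X z -> X w ->
      gromov_product dist x y w >=
        Rmin (gromov_product dist x z w) (gromov_product dist z y w) - delta.

Definition is_cd_affine {d} (F : Cd d -> Cd d) : Prop :=
  exists (M : 'I_d -> 'I_d -> C) (b : Cd d),
    forall z i, F z i = Cplus (\big[Cplus/RtoC 0]_(j < d) Cmult (M i j) (z j)) (b i).

Definition Aff {d} (F : Cd d -> Cd d) : Prop :=
  is_cd_affine F /\ exists G : Cd d -> Cd d, (forall z, G (F z) = z) /\ (forall z, F (G z) = z).

Definition cd_image {d} (F : Cd d -> Cd d) (A : cd_set d) : cd_set d :=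
  fun w => exists z, A z /\ w = F z.

Definition cd_closure {d} (A : cd_set d) : cd_set d :=
  fun x => forall eps, 0 < eps -> exists y, A y /\ cd_dist x y < eps.

Definition cd_closed_ball {d} (R0 : R) : cd_set d := fun x => cd_norm x <= R0.

Definition cd_inter {d} (A B : cd_set d) : cd_set d := fun x => A x /\ B x.

Definition cd_nbhd {d} (A : cd_set d) (eps : R) : cd_set d :=
  fun x => exists y, A y /\ cd_dist x y <= eps.

Definition hausdorff_dist {d} (K L : cd_set d) : Rbar :=
  Glb_Rbar (fun eps => 0 <= eps /\
    (forall x, K x -> cd_nbhd L eps x) /\ (forall x, L x -> cd_nbhd K eps x)).

Definition local_hausdorff_cvg {d} (An : nat -> cd_set d) (A : cd_set d) : Prop :=
  forall R0 : R, 0 < R0 ->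
    forall eps : R, 0 < eps -> exists N : nat, forall n : nat, (N <= n)%nat ->
      Rbar_lt (hausdorff_dist (cd_inter (cd_closure (An n)) (cd_closed_ball R0))
                              (cd_inter (cd_closure A) (cd_closed_ball R0))) eps.

(* Main.v *)
Require Import Defs.
From HB Require Import structures.
From Stdlib Require Import Reals Lra ClassicalEpsilon FunctionalExtensionality.
From Coquelicot Require Import Coquelicot.
From mathcomp Require Import ssreflect ssrfun ssrbool eqtype ssrnat seq fintype bigop.

(** Kobayashi distances are invariant under affine maps, so the sets
[Omega_n = A_n Omega] satisfy the four-point condition with the constant of
[Omega]; it passes to the limit as soon as
[d_{Omega_n}(p, q) -> d_{hat Omega}(p, q)] for all [p], [q] in [hat Omega].
For the upper bound, shrink the discs of a chain in [hat Omega] so that their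
images become relatively compact, hence contained in [Omega_n] for large [n].
For the lower bound, shrink the discs of a chain in [Omega_n]: their images then
stay in a Kobayashi ball of fixed radius, which is Euclidean bounded uniformly
in [n] because [hat Omega] contains no complex line (separate [Omega_n] from a
point of a complex line and apply Schwarz' lemma for the half plane), and on
bounded sets [Omega_n] lies in a dilate of [hat Omega] by a factor close to 1. *)

(** * Complex differentiability *)

(** The lower bound is the delicate one: the chains in [An n] vary with [n] and the number of their
    links is unbounded. A fixed error per link would accumulate, so the loss caused by shrinking a
    disc must be a fraction of the length of the link. [psi_shrink] gives this uniformly, because no
    link of a chain of length at most [r0] has parameter above [1 - exp (- (2 * r0))]. Links are
    normalised to run from the centre of the disc to a real point [t], so that a concentric disc of
    radius above [t] contains both ends. The dilation into the limit is centred at [p] and therefore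
    moves [q]; a short link in a ball around [q] closes the gap.

    Schwarz' lemma is derived from Goursat's theorem without Cauchy's integral formula or power
    series. The quotient [f z / z] is then known to be holomorphic only away from the origin and
    continuous there, so the mean value property and the maximum principle are proved for functions
    with such an exceptional point. *)

Lemma Re_plus (a b : C) : Re (a + b)%C = Re a + Re b. Proof. by []. Qed.
Lemma Re_minus (a b : C) : Re (a - b)%C = Re a - Re b. Proof. by []. Qed.
Lemma Re_mult (a b : C) : Re (a * b)%C = Re a * Re b - Im a * Im b. Proof. by []. Qed.
Lemma Im_plus (a b : C) : Im (a + b)%C = Im a + Im b. Proof. by []. Qed.
Lemma Im_minus (a b : C) : Im (a - b)%C = Im a - Im b. Proof. by []. Qed.
Lemma Im_mult (a b : C) : Im (a * b)%C = Re a * Im b + Im a * Re b. Proof. by []. Qed.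

Lemma Re_conj (a : C) : Re (Cconj a) = Re a. Proof. by []. Qed.
Lemma Im_conj (a : C) : Im (Cconj a) = - Im a. Proof. by []. Qed.

Lemma Ceq (a b : C) : Re a = Re b -> Im a = Im b -> a = b.
Proof. by case: a b => [a1 a2] [b1 b2] /= -> ->. Qed.

Lemma Cmod_sqr (z : C) : Cmod z * Cmod z = Re z * Re z + Im z * Im z.
Proof. rewrite -/(Rsqr _) Rsqr_pow2 Cmod2_alt; ring. Qed.

Lemma Cmod_minus_sym (a b : C) : Cmod (a - b)%C = Cmod (b - a)%C.
Proof. rewrite -Cmod_opp; congr Cmod; ring. Qed.

Lemma Cmod_minus_eq0 (a b : C) : Cmod (a - b)%C = 0 -> a = b.
Proof. move/Cmod_eq_0 => H; rewrite -[b]Cplus_0_r -H; ring. Qed.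

Lemma Cmod_le_dist (a b : C) : Cmod a <= Cmod b + Cmod (a - b)%C.
Proof.
have {1}-> : (a = b + (a - b))%C by ring.
exact: Cmod_triangle.
Qed.

Lemma Cmod_ge_dist (a b : C) : Cmod a - Cmod b <= Cmod (a - b)%C.
Proof. have := Cmod_le_dist a b; lra. Qed.

Lemma Im_le_Cmod (z : C) : Rabs (Im z) <= Cmod z.
Proof. exact: Rle_trans (Rmax_r _ _) (Rmax_Cmod z). Qed.

Lemma Cmod_le_ReIm (z : C) : Cmod z <= Rabs (Re z) + Rabs (Im z).
Proof.
have P1 := Rabs_pos (Re z); have P2 := Rabs_pos (Im z).
apply: Rsqr_incr_0_var; last lra.
rewrite {1}/Rsqr Cmod_sqr.
have -> : Re z * Re z = Rabs (Re z) * Rabs (Re z) by rewrite -Rabs_mult Rabs_pos_eq //; nra.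
have -> : Im z * Im z = Rabs (Im z) * Rabs (Im z) by rewrite -Rabs_mult Rabs_pos_eq //; nra.
rewrite /Rsqr; nra.
Qed.

Definition ccont (f : C -> C) (z : C) : Prop :=
  forall eps, 0 < eps -> exists dl, 0 < dl /\
    forall w, Cmod (w - z)%C < dl -> Cmod (f w - f z)%C < eps.

(* Caratheodory's form of complex differentiability: the difference quotient
   is replaced by a function continuous at [z]. *)
Definition cdiff (f : C -> C) (z : C) : Prop :=
  exists phi, ccont phi z /\ exists dl, 0 < dl /\
    forall w, Cmod (w - z)%C < dl -> f w = (f z + phi w * (w - z))%C.

Lemma ccont_ext_loc (f g : C -> C) z dl : 0 < dl ->
  (forall w, Cmod (w - z)%C < dl -> f w = g w) -> ccont f z -> ccont g z.
Proof.
move=> d0 E cf e e0; have [d [dp H]] := cf e e0.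
exists (Rmin d dl); split; first exact: Rmin_pos.
move=> w Hw.
have H1 := Rmin_l d dl; have H2 := Rmin_r d dl.
rewrite -E; last lra.
rewrite -(E z); first by apply: H; lra.
have -> : (z - z = 0)%C by ring.
by rewrite Cmod_0.
Qed.

Lemma ccont_const c z : ccont (fun _ => c) z.
Proof.
move=> e e0; exists 1; split; first lra.
by move=> w _; rewrite (_ : (c - c = 0)%C) ?Cmod_0 //; ring.
Qed.

Lemma ccont_id z : ccont id z.
Proof. by move=> e e0; exists e. Qed.

Lemma ccont_plus f g z : ccont f z -> ccont g z -> ccont (fun w => f w + g w)%C z.
Proof.
move=> cf cg e e0; have [d1 [p1 H1]] := cf (e / 2) ltac:(lra).
have [d2 [p2 H2]] := cg (e / 2) ltac:(lra).
exists (Rmin d1 d2); split; first exact: Rmin_pos.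
move=> w Hw; have L1 := Rmin_l d1 d2; have L2 := Rmin_r d1 d2.
have := H1 w ltac:(lra); have := H2 w ltac:(lra).
have -> : (f w + g w - (f z + g z) = (f w - f z) + (g w - g z))%C by ring.
have := Cmod_triangle (f w - f z)%C (g w - g z)%C; lra.
Qed.

Lemma ccont_mult f g z : ccont f z -> ccont g z -> ccont (fun w => f w * g w)%C z.
Proof.
move=> cf cg e e0.
set F := Cmod (f z); set G := Cmod (g z).
have F0 : 0 <= F := Cmod_ge_0 _; have G0 : 0 <= G := Cmod_ge_0 _.
have [d0 [p0 H0]] := cf 1 ltac:(lra).
have q1 : 0 < e / 2 / (G + 1) by apply: Rdiv_lt_0_compat; lra.
have q2 : 0 < e / 2 / (F + 1) by apply: Rdiv_lt_0_compat; lra.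
have [d1 [p1 H1]] := cf _ q1.
have [d2 [p2 H2]] := cg _ q2.
exists (Rmin d0 (Rmin d1 d2)); split; first by repeat apply: Rmin_pos.
move=> w Hw; have L0 := Rmin_l d0 (Rmin d1 d2).
have L := Rmin_r d0 (Rmin d1 d2).
have L1 := Rmin_l d1 d2; have L2 := Rmin_r d1 d2.
have {H0}K0 := H0 w ltac:(lra); have {H1}K1 := H1 w ltac:(lra); have {H2}K2 := H2 w ltac:(lra).
have -> : (f w * g w - f z * g z = f w * (g w - g z) + (f w - f z) * g z)%C by ring.
have := Cmod_triangle (f w * (g w - g z))%C ((f w - f z) * g z)%C.
rewrite !Cmod_mult -/G.
have B : Cmod (f w) <= F + 1 by have := Cmod_le_dist (f w) (f z); rewrite -/F; lra.
have E1 : Cmod (f w) * Cmod (g w - g z)%C <= (F + 1) * Cmod (g w - g z)%C.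
  by apply: Rmult_le_compat_r B; exact: Cmod_ge_0.
have E2 : (F + 1) * Cmod (g w - g z)%C < e / 2.
  have -> : e / 2 = (F + 1) * (e / 2 / (F + 1)) by field; lra.
  by apply: Rmult_lt_compat_l K2; lra.
have E3 : Cmod (f w - f z)%C * G <= e / 2.
  have -> : e / 2 = (e / 2 / (G + 1)) * (G + 1) by field; lra.
  apply: Rmult_le_compat; try lra; exact: Cmod_ge_0.
lra.
Qed.

Lemma ccont_nonzero f z : ccont f z -> f z <> 0 ->
  exists dl, 0 < dl /\ forall w, Cmod (w - z)%C < dl -> Cmod (f z) / 2 < Cmod (f w).
Proof.
move=> cf nz; have m0 : 0 < Cmod (f z) by apply/Cmod_gt_0.
have [d [dp H]] := cf (Cmod (f z) / 2) ltac:(lra).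
exists d; split => // w Hw; have := H w Hw.
have := Cmod_le_dist (f z) (f w); rewrite (Cmod_minus_sym (f z)); lra.
Qed.

Lemma Cmod_gt0_neq (z : C) : 0 < Cmod z -> z <> 0.
Proof. by move=> H E; rewrite E Cmod_0 in H; lra. Qed.

Lemma ccont_inv f z : ccont f z -> f z <> 0 -> ccont (fun w => / f w)%C z.
Proof.
move=> cf nz e e0; have m0 : 0 < Cmod (f z) by apply/Cmod_gt_0.
have [d1 [p1 H1]] := ccont_nonzero _ _ cf nz.
set m := Cmod (f z) in m0 H1 *.
have q : 0 < e * (m / 2) * m by do 2![apply: Rmult_lt_0_compat => //]; lra.
have [d2 [p2 H2]] := cf _ q.
exists (Rmin d1 d2); split; first exact: Rmin_pos.
move=> w Hw; have L1 := Rmin_l d1 d2; have L2 := Rmin_r d1 d2.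
have {H1}K1 := H1 w ltac:(lra); have {H2}K2 := H2 w ltac:(lra).
have nw : f w <> 0 by apply: Cmod_gt0_neq; lra.
have -> : (/ f w - / f z = (f z - f w) * (/ f w * / f z))%C by field; split.
rewrite !Cmod_mult !Cmod_inv // -/m Cmod_minus_sym.
have i1 : 0 < / Cmod (f w) by apply: Rinv_0_lt_compat; lra.
have i2 : 0 < / m by apply: Rinv_0_lt_compat.
apply: (Rlt_le_trans _ (e * (m / 2) * m * (/ Cmod (f w) * / m))).
  by apply: Rmult_lt_compat_r => //; exact: Rmult_lt_0_compat.
have -> : e * (m / 2) * m * (/ Cmod (f w) * / m) = e * ((m / 2) * / Cmod (f w)) by field; lra.
have : m / 2 * / Cmod (f w) <= 1.
  apply: (Rmult_le_reg_r (Cmod (f w))); first lra.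
  rewrite Rmult_assoc Rinv_l; lra.
nra.
Qed.

Lemma ccont_comp f g z : ccont g z -> ccont f (g z) -> ccont (fun w => f (g w)) z.
Proof.
move=> cg cf e e0; have [d1 [p1 H1]] := cf e e0; have [d2 [p2 H2]] := cg d1 p1.
by exists d2; split => // w /H2 /H1.
Qed.

Lemma cdiff_ccont f z : cdiff f z -> ccont f z.
Proof.
move=> [phi [cp [d [d0 E]]]].
apply: (ccont_ext_loc (fun w => f z + phi w * (w - z))%C _ _ d d0); first by move=> w /E ->.
apply: ccont_plus; first exact: ccont_const.
apply: ccont_mult => //; apply: ccont_plus; first exact: ccont_id.
exact: ccont_const.
Qed.

Lemma cdiff_ext_loc f g z dl : 0 < dl ->
  (forall w, Cmod (w - z)%C < dl -> f w = g w) -> cdiff f z -> cdiff g z.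
Proof.
move=> dl0 E [phi [cp [d [d0 H]]]]; exists phi; split => //.
exists (Rmin d dl); split; first exact: Rmin_pos.
move=> w Hw; have L1 := Rmin_l d dl; have L2 := Rmin_r d dl.
rewrite -(E w); last lra.
rewrite -(E z); first by apply: H; lra.
have -> : (z - z = 0)%C by ring.
by rewrite Cmod_0.
Qed.

Lemma cdiff_const c z : cdiff (fun _ => c) z.
Proof.
exists (fun _ => RtoC 0); split; first exact: ccont_const.
exists 1; split; first lra.
move=> w _; ring.
Qed.

Lemma cdiff_id z : cdiff id z.
Proof.
exists (fun _ => RtoC 1); split; first exact: ccont_const.
exists 1; split; first lra.
move=> w _ /=; ring.
Qed.

Lemma cdiff_plus f g z : cdiff f z -> cdiff g z -> cdiff (fun w => f w + g w)%C z.
Proof.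
move=> [p [cp [d1 [d10 E1]]]] [q [cq [d2 [d20 E2]]]].
exists (fun w => p w + q w)%C; split; first exact: ccont_plus.
exists (Rmin d1 d2); split; first exact: Rmin_pos.
move=> w Hw; have L1 := Rmin_l d1 d2; have L2 := Rmin_r d1 d2.
rewrite (E1 w) 1?(E2 w); try lra; ring.
Qed.

Lemma cdiff_mult f g z : cdiff f z -> cdiff g z -> cdiff (fun w => f w * g w)%C z.
Proof.
move=> df dg; have cg := cdiff_ccont _ _ dg.
case: df dg => [p [cp [d1 [d10 E1]]]] [q [cq [d2 [d20 E2]]]].
exists (fun w => p w * g w + f z * q w)%C; split.
  apply: ccont_plus; apply: ccont_mult => //; exact: ccont_const.
exists (Rmin d1 d2); split; first exact: Rmin_pos.
move=> w Hw; have L1 := Rmin_l d1 d2; have L2 := Rmin_r d1 d2.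
rewrite (E1 w) 1?(E2 w); try lra; ring.
Qed.

Lemma cdiff_inv f z : cdiff f z -> f z <> 0 -> cdiff (fun w => / f w)%C z.
Proof.
move=> df nz; have cf := cdiff_ccont _ _ df.
case: df => [p [cp [d1 [d10 E1]]]].
have [d2 [p2 H2]] := ccont_nonzero _ _ cf nz.
exists (fun w => - (1) * p w * (/ f w * / f z))%C; split.
  apply: ccont_mult; first by apply: ccont_mult => //; exact: ccont_const.
  by apply: ccont_mult; [exact: ccont_inv | exact: ccont_const].
exists (Rmin d1 d2); split; first exact: Rmin_pos.
move=> w Hw; have L1 := Rmin_l d1 d2; have L2 := Rmin_r d1 d2.
have nw : f w <> 0.
  by apply: Cmod_gt0_neq; have := H2 w ltac:(lra); have := Cmod_ge_0 (f z); lra.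
have E : (f w - f z = p w * (w - z))%C by rewrite (E1 w); [ring | lra].
transitivity (/ f z - (f w - f z) * (/ f w * / f z))%C; first by field; split.
rewrite E; ring.
Qed.

Lemma cdiff_comp f g z : cdiff g z -> cdiff f (g z) -> cdiff (fun w => f (g w)) z.
Proof.
move=> dg; have cg := cdiff_ccont _ _ dg.
case: dg => [p [cp [d1 [d10 E1]]]] [q [cq [d2 [d20 E2]]]].
have [d3 [p3 H3]] := cg d2 d20.
exists (fun w => q (g w) * p w)%C; split.
  by apply: ccont_mult => //; exact: (ccont_comp q g).
exists (Rmin d1 d3); split; first exact: Rmin_pos.
move=> w Hw; have L1 := Rmin_l d1 d3; have L2 := Rmin_r d1 d3.
rewrite (E2 (g w)); last by apply: H3; lra.
rewrite {2}(E1 w); last lra.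
ring.
Qed.

(** Giving the difference quotient the value [l] at [z] makes it continuous there; this converts a
    first-order Taylor estimate into Caratheodory's form. *)
Lemma cdiff_estimate (f : C -> C) (z l : C) :
  (forall e, 0 < e -> exists d, 0 < d /\ forall w, Cmod (w - z)%C < d ->
     Cmod (f w - f z - l * (w - z))%C <= e * Cmod (w - z)%C) -> cdiff f z.
Proof.
move=> D.
exists (fun w => if excluded_middle_informative (w = z) then l else (f w - f z) / (w - z))%C.
split.
- move=> e e0; have [d [d0 Hd]] := D (e / 2) ltac:(lra).
  exists d; split => // w Hw.
  case: (excluded_middle_informative (z = z)) => // ? /=.
  case: (excluded_middle_informative (w = z)) => [? /=|nw].
    have -> : (l - l = 0)%C by ring.
    by rewrite Cmod_0.
  have H := Hd w Hw.
  have nz : (w - z)%C <> 0 by move=> K; apply: nw; apply: Cmod_minus_eq0; rewrite K Cmod_0.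
  have p0 : 0 < Cmod (w - z) by apply/Cmod_gt_0.
  have -> : ((f w - f z) / (w - z) - l = (f w - f z - l * (w - z)) / (w - z))%C by field.
  rewrite Cmod_div //.
  apply: (Rle_lt_trans _ (e / 2)); last lra.
  apply: (Rmult_le_reg_r (Cmod (w - z))) => //.
  by rewrite /Rdiv Rmult_assoc Rinv_l ?Rmult_1_r; last lra.
- exists 1; split; first lra.
  move=> w _; case: excluded_middle_informative => [E|nw] /=; first by rewrite E; ring.
  have nz : (w - z)%C <> 0 by move=> K; apply: nw; apply: Cmod_minus_eq0; rewrite K Cmod_0.
  by field.
Qed.

Lemma ex_derive_cdiff (f : C -> C) (z : C) :
  @ex_derive C_AbsRing C_NormedModule f z <-> cdiff f z.
Proof.
split.
- case=> l [_ /(_ z (fun P H => H)) D].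
  apply: (cdiff_estimate _ _ l) => e e0.
  have [d Hd] := D (mkposreal _ e0).
  exists d; split; first exact: cond_pos.
  move=> w Hw.
  have H : Cmod (f w - f z - (w - z) * l)%C <= e * Cmod (w - z)%C := Hd w Hw.
  by rewrite (Cmult_comm l).
- move=> [p [cp [d [d0 E]]]]; exists (p z); split; first exact: is_linear_scal_l.
  move=> x Hx; have <- := is_filter_lim_locally_unique _ _ Hx => e.
  have [d2 [d20 H]] := cp e (cond_pos e).
  have d30 : 0 < Rmin d d2 by apply: Rmin_pos.
  exists (mkposreal _ d30) => w Hw.
  have L1 := Rmin_l d d2; have L2 := Rmin_r d d2.
  have {}Hw : Cmod (w - z)%C < Rmin d d2 by exact: Hw.
  rewrite (E w); last lra.
  change (Cmod (f z + p w * (w - z) - f z - (w - z) * p z)%C <= e * Cmod (w - z)%C).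
  have -> : (f z + p w * (w - z) - f z - (w - z) * p z = (p w - p z) * (w - z))%C by ring.
  rewrite Cmod_mult; apply: Rmult_le_compat_r; first exact: Cmod_ge_0.
  by apply: Rlt_le; apply: H; lra.
Qed.

(** * Cluster points and maxima *)

Lemma inv_INR_lt (e : R) : 0 < e -> exists N : nat, forall n, (N <= n)%N -> / INR n.+1 < e.
Proof.
move=> e0; have [N [HN HN0]] := archimed_cor1 e e0.
exists N => n /leP/le_INR Hn.
have := lt_0_INR N HN0 => N0.
apply: Rlt_trans HN; apply: Rinv_lt_contravar; rewrite S_INR; nra.
Qed.

(* For an extraction [phi], the condition [n <= phi n] is stable under
   composition and is all that is used of monotonicity. *)
Lemma real_cluster (u : nat -> R) (M : R) : (forall n, Rabs (u n) <= M) ->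
  exists (phi : nat -> nat) (l : R), (forall n, (n <= phi n)%N) /\
    forall e, 0 < e -> exists N, forall n, (N <= n)%N -> Rabs (u (phi n) - l) < e.
Proof.
move=> Hu.
have [l Hl] := Bolzano_Weierstrass u (fun x => - M <= x <= M) (compact_P3 _ _)
  (fun n => (Rabs_le_between _ _).1 (Hu n)).
have Hn n : exists p, (n <= p)%N /\ Rabs (u p - l) < / INR n.+1.
  have p0 : 0 < / INR n.+1 by apply: Rinv_0_lt_compat; apply: lt_0_INR; apply/ltP.
  have [p [/leP Hp Hd]] := Hl (disc l (mkposreal _ p0)) n (ex_intro _ _ (fun x H => H)).
  by exists p.
exists (fun n => proj1_sig (constructive_indefinite_description _ (Hn n))), l; split.
  by move=> n; case: constructive_indefinite_description => p [].
move=> e e0; have [N HN] := inv_INR_lt e e0; exists N => n /HN.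
case: constructive_indefinite_description => p [_] /= Hp; lra.
Qed.

Definition ctendsto (u : nat -> C) (l : C) : Prop :=
  forall e, 0 < e -> exists N, forall n, (N <= n)%N -> Cmod (u n - l)%C < e.

Lemma ctendsto_sub u l (phi : nat -> nat) : (forall n, (n <= phi n)%N) ->
  ctendsto u l -> ctendsto (fun n => u (phi n)) l.
Proof.
move=> Hphi Hu e e0; have [N HN] := Hu e e0; exists N => n Hn.
by apply: HN; apply: leq_trans (Hphi n).
Qed.

Lemma ccont_ctendsto f z u : ccont f z -> ctendsto u z -> ctendsto (fun n => f (u n)) (f z).
Proof.
move=> cf Hu e e0; have [d [d0 H]] := cf e e0; have [N HN] := Hu d d0.
by exists N => n /HN /H.
Qed.

Lemma complex_cluster (u : nat -> C) (M : R) : (forall n, Cmod (u n) <= M) ->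
  exists (phi : nat -> nat) (l : C), (forall n, (n <= phi n)%N) /\ ctendsto (fun n => u (phi n)) l.
Proof.
move=> Hu.
have [p1 [l1 [P1 L1]]] := real_cluster (fun n => Re (u n)) M
  (fun n => Rle_trans _ _ _ (re_le_Cmod _) (Hu n)).
have [p2 [l2 [P2 L2]]] := real_cluster (fun n => Im (u (p1 n))) M
  (fun n => Rle_trans _ _ _ (Im_le_Cmod _) (Hu _)).
exists (fun n => p1 (p2 n)), (l1, l2); split.
  by move=> n; apply: leq_trans (P2 n) (P1 _).
move=> e e0; have [N1 H1] := L1 (e / 2) ltac:(lra); have [N2 H2] := L2 (e / 2) ltac:(lra).
exists (maxn N1 N2) => n; rewrite geq_max => /andP[K1 K2].
apply: Rle_lt_trans (Cmod_le_ReIm _) _; rewrite Re_minus Im_minus /=.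
have := H1 (p2 n) (leq_trans K1 (P2 n)); have := H2 n K2; lra.
Qed.

Lemma Cmod_ctendsto_le u l M : ctendsto u l -> (forall n, Cmod (u n) <= M) -> Cmod l <= M.
Proof.
move=> Hu HM; apply: Rnot_lt_le => H.
have [N /(_ N (leqnn N)) K] := Hu (Cmod l - M) ltac:(lra).
have := Cmod_le_dist l (u N); rewrite (Cmod_minus_sym l); have := HM N; lra.
Qed.

(** Cluster points are used twice: points with values beyond every bound would accumulate where [F]
    is continuous, and near-maximisers accumulate at a maximiser. *)
Lemma disc_max (F : C -> R) (r : R) : 0 <= r ->
  (forall z, Cmod z <= r -> forall e, 0 < e -> exists d, 0 < d /\
     forall w, Cmod (w - z)%C < d -> Rabs (F w - F z) < e) ->
  exists z, Cmod z <= r /\ forall w, Cmod w <= r -> F w <= F z.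
Proof.
move=> r0 cF.
have Hbd : exists M, forall z, Cmod z <= r -> F z <= M.
  apply: NNPP => nH.
  have Hn n : exists z, Cmod z <= r /\ INR n < F z.
    apply: NNPP => H; apply: nH; exists (INR n) => z Hz; apply: Rnot_lt_le => K.
    by apply: H; exists z.
  pose u n := proj1_sig (constructive_indefinite_description _ (Hn n)).
  have Hu n : Cmod (u n) <= r /\ INR n < F (u n).
    by rewrite /u; case: constructive_indefinite_description.
  have [phi [l [P L]]] := complex_cluster u r (fun n => (Hu n).1).
  have Hl : Cmod l <= r := Cmod_ctendsto_le _ _ _ L (fun n => (Hu _).1).
  have [d [d0 Hd]] := cF l Hl 1 ltac:(lra).
  have [N HN] := L d d0.
  have [m Hm] := INR_unbounded (F l + 1).
  have := Hd _ (HN (maxn N m) (leq_maxl _ _)).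
  have := (Hu (phi (maxn N m))).2.
  have := le_INR _ _ (elimT leP (leq_trans (leq_maxr N m) (P (maxn N m)))).
  by move=> A1 A2 /Rabs_def2 [A3 A4]; lra.
have [M HM] := Hbd.
have [S [HS1 HS2]] := completeness (fun y => exists z, Cmod z <= r /\ F z = y)
  (ex_intro _ M (fun y H => let: ex_intro z (conj Hz E) := H in eq_ind _ (fun y => y <= M) (HM z Hz) _ E))
  (ex_intro _ (F 0) (ex_intro _ (RtoC 0) (conj (eq_ind_r (fun x => x <= r) r0 Cmod_0) erefl))).
have Hn n : exists z, Cmod z <= r /\ S - / INR n.+1 < F z.
  apply: NNPP => H.
  have p0 : 0 < / INR n.+1 by apply: Rinv_0_lt_compat; apply: lt_0_INR; apply/ltP.
  have : S <= S - / INR n.+1.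
    apply: HS2 => y [z [Hz <-]]; apply: Rnot_lt_le => K; apply: H; by exists z.
  lra.
pose u n := proj1_sig (constructive_indefinite_description _ (Hn n)).
have Hu n : Cmod (u n) <= r /\ S - / INR n.+1 < F (u n).
  by rewrite /u; case: constructive_indefinite_description.
have [phi [l [P L]]] := complex_cluster u r (fun n => (Hu n).1).
have Hl : Cmod l <= r := Cmod_ctendsto_le _ _ _ L (fun n => (Hu _).1).
exists l; split => // w Hw.
apply: Rle_trans (HS1 _ _) _; first by exists w.
apply: Rnot_lt_le => K.
have [d [d0 Hd]] := cF l Hl ((S - F l) / 2) ltac:(lra).
have [N HN] := L d d0.
have [m Hm] := inv_INR_lt ((S - F l) / 2) ltac:(lra).
have := Hd _ (HN (maxn N m) (leq_maxl _ _)).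
have := (Hu (phi (maxn N m))).2.
have := Hm (phi (maxn N m)) (leq_trans (leq_maxr N m) (P (maxn N m))).
by move=> A1 A2 /Rabs_def2 [A3 A4]; lra.
Qed.

(** * Goursat's theorem *)

Lemma RInt_near_const (F : R -> R) (a b k e : R) : a <= b -> ex_RInt F a b ->
  (forall x, a <= x <= b -> Rabs (F x - k) <= e) ->
  Rabs (RInt F a b - (b - a) * k) <= (b - a) * e.
Proof.
move=> ab iF H.
have ik : ex_RInt (fun _ => k) a b by exact: ex_RInt_const.
have -> : RInt F a b - (b - a) * k = RInt (fun x => F x - k) a b.
  have := RInt_minus F (fun _ => k) a b iF ik.
  rewrite RInt_const /minus /plus /opp /scal /= /mult /= => ->.
  by [].
apply: abs_RInt_le_const => //.
exact: (ex_RInt_minus (V := R_NormedModule)).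
Qed.

(** Meant for a horizontal or vertical path [p] and for [L] equal to [Re] or [Im], all of them
    1-Lipschitz; it makes the side integrals exist. *)
Lemma continuous_slice (g : C -> C) (p : R -> C) (L : C -> R) (t : R) :
  (forall s, Cmod (p s - p t)%C <= Rabs (s - t)) ->
  (forall u v, Rabs (L u - L v) <= Cmod (u - v)%C) ->
  ccont g (p t) -> continuous (fun s => L (g (p s))) t.
Proof.
move=> Hp HL cg; apply/filterlim_locally => e.
have [d [d0 H]] := cg e (cond_pos e).
exists (mkposreal _ d0) => s Hs.
have {}Hs : Rabs (s - t) < d by exact: Hs.
change (Rabs (L (g (p s)) - L (g (p t))) < e).
apply: Rle_lt_trans (HL _ _) _; apply: H; exact: Rle_lt_trans (Hp s) Hs.
Qed.

Lemma Cmod_real_dist (x x' c : R) : Cmod ((x, c) - (x', c))%C <= Rabs (x - x').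
Proof.
apply: Rle_trans (Cmod_le_ReIm _) _; rewrite Re_minus Im_minus /=.
rewrite Rminus_diag Rabs_R0; lra.
Qed.

Lemma Cmod_imag_dist (x y y' : R) : Cmod ((x, y) - (x, y'))%C <= Rabs (y - y').
Proof.
apply: Rle_trans (Cmod_le_ReIm _) _; rewrite Re_minus Im_minus /=.
rewrite Rminus_diag Rabs_R0; lra.
Qed.

Lemma Re_dist_le (u v : C) : Rabs (Re u - Re v) <= Cmod (u - v)%C.
Proof. by rewrite -Re_minus; exact: re_le_Cmod. Qed.

Lemma Im_dist_le (u v : C) : Rabs (Im u - Im v) <= Cmod (u - v)%C.
Proof. by rewrite -Im_minus; exact: Im_le_Cmod. Qed.

Definition rect_cont (g : C -> C) (a b c d : R) : Prop :=
  forall x y, a <= x <= b -> c <= y <= d -> ccont g (x, y).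

Lemma ex_RInt_hslice g a b c d y : a <= b -> c <= y <= d -> rect_cont g a b c d ->
  ex_RInt (fun x => Re (g (x, y))) a b.
Proof.
move=> ab cyd cg; apply: ex_RInt_continuous => x; rewrite Rmin_left // Rmax_right // => Hx.
apply: (continuous_slice g (fun x => (x, y)) Re x); last exact: cg.
- by move=> s; exact: Cmod_real_dist.
- exact: Re_dist_le.
Qed.

Lemma ex_RInt_vslice g a b c d x : c <= d -> a <= x <= b -> rect_cont g a b c d ->
  ex_RInt (fun y => Im (g (x, y))) c d.
Proof.
move=> cd axb cg; apply: ex_RInt_continuous => y; rewrite Rmin_left // Rmax_right // => Hy.
apply: (continuous_slice g (fun y => (x, y)) Im y); last exact: cg.
- by move=> s; exact: Cmod_imag_dist.
- exact: Im_dist_le.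
Qed.

(* The real part of the integral of [g] along the boundary of [a,b] x [c,d]. *)
Definition rect_int (g : C -> C) (a b c d : R) : R :=
  RInt (fun x => Re (g (x, c))) a b - RInt (fun x => Re (g (x, d))) a b
  - (RInt (fun y => Im (g (b, y))) c d - RInt (fun y => Im (g (a, y))) c d).

Lemma rect_int_split_x g a m b c d : a <= m <= b -> c <= d -> rect_cont g a b c d ->
  rect_int g a b c d = rect_int g a m c d + rect_int g m b c d.
Proof.
move=> amb cd cg.
have I y : c <= y <= d -> ex_RInt (fun x => Re (g (x, y))) a b.
  by move=> Hy; apply: (ex_RInt_hslice g a b c d) => //; lra.
have S y : c <= y <= d -> RInt (fun x => Re (g (x, y))) a b =
   RInt (fun x => Re (g (x, y))) a m + RInt (fun x => Re (g (x, y))) m b.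
  move=> /I Iy; rewrite -(RInt_Chasles _ a m b) //.
  - exact: (ex_RInt_Chasles_1 _ a m b).
  - exact: (ex_RInt_Chasles_2 _ a m b).
rewrite /rect_int !S; try lra.
Qed.

Lemma rect_int_split_y g a b c m d : a <= b -> c <= m <= d -> rect_cont g a b c d ->
  rect_int g a b c d = rect_int g a b c m + rect_int g a b m d.
Proof.
move=> ab cmd cg.
have I x : a <= x <= b -> ex_RInt (fun y => Im (g (x, y))) c d.
  by move=> Hx; apply: (ex_RInt_vslice g a b c d) => //; lra.
have S x : a <= x <= b -> RInt (fun y => Im (g (x, y))) c d =
   RInt (fun y => Im (g (x, y))) c m + RInt (fun y => Im (g (x, y))) m d.
  move=> /I Ix; rewrite -(RInt_Chasles _ c m d) //.
  - exact: (ex_RInt_Chasles_1 _ c m d).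
  - exact: (ex_RInt_Chasles_2 _ c m d).
rewrite /rect_int !S; try lra.
Qed.

Lemma rect_cont_sub g a b c d a' b' c' d' : a <= a' -> b' <= b -> c <= c' -> d' <= d ->
  rect_cont g a b c d -> rect_cont g a' b' c' d'.
Proof. move=> H1 H2 H3 H4 cg x y Hx Hy; apply: cg; lra. Qed.

(** The inner sides cancel, so the four quarters add up to the whole and one of them carries at
    least a quarter of its absolute value. Width and height are parameters because all quarters
    share them. *)
Lemma rect_int_quarter g a c w h : 0 <= w -> 0 <= h ->
  rect_cont g a (a + w) c (c + h) ->
  exists a' c', (a' = a \/ a' = a + w / 2) /\ (c' = c \/ c' = c + h / 2) /\
    Rabs (rect_int g a (a + w) c (c + h)) <=
    4 * Rabs (rect_int g a' (a' + w / 2) c' (c' + h / 2)).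
Proof.
move=> w0 h0 cg.
have E1 := rect_int_split_x g a (a + w / 2) (a + w) c (c + h) ltac:(lra) ltac:(lra) cg.
have E2 := rect_int_split_y g a (a + w / 2) c (c + h / 2) (c + h) ltac:(lra) ltac:(lra)
  (rect_cont_sub g a (a + w) c (c + h) a (a + w / 2) c (c + h)
     ltac:(lra) ltac:(lra) ltac:(lra) ltac:(lra) cg).
have E3 := rect_int_split_y g (a + w / 2) (a + w) c (c + h / 2) (c + h) ltac:(lra) ltac:(lra)
  (rect_cont_sub g a (a + w) c (c + h) (a + w / 2) (a + w) c (c + h)
     ltac:(lra) ltac:(lra) ltac:(lra) ltac:(lra) cg).
have Ew : a + w = a + w / 2 + w / 2 by lra.
have Eh : c + h = c + h / 2 + h / 2 by lra.
apply: NNPP => nH.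
have N a' c' : (a' = a \/ a' = a + w / 2) -> (c' = c \/ c' = c + h / 2) ->
    4 * Rabs (rect_int g a' (a' + w / 2) c' (c' + h / 2)) <
    Rabs (rect_int g a (a + w) c (c + h)).
  by move=> Ha Hc; apply: Rnot_le_lt => K; apply: nH; exists a', c'.
have := N a c (or_introl erefl) (or_introl erefl).
have := N a (c + h / 2) (or_introl erefl) (or_intror erefl).
have := N (a + w / 2) c (or_intror erefl) (or_introl erefl).
have := N (a + w / 2) (c + h / 2) (or_intror erefl) (or_intror erefl).
rewrite -Ew -Eh E1 E2 E3.
set p := rect_int g a _ c _; set q := rect_int g a _ _ _.
set r := rect_int g _ _ c _; set s := rect_int g _ _ _ _.
have := Rabs_triang (p + q) (r + s).
have := Rabs_triang p q; have := Rabs_triang r s; lra.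
Qed.

(* Subtracting the first-order Taylor polynomial of [g] at [z0] does not change
   the integral; the remainder is at most [e * diameter]. *)
Lemma rect_int_small g a c w h z0 l e : 0 <= w -> 0 <= h -> 0 <= e ->
  rect_cont g a (a + w) c (c + h) ->
  (forall x y, a <= x <= a + w -> c <= y <= c + h ->
     Cmod (g (x, y) - g z0 - l * ((x, y) - z0))%C <= e) ->
  Rabs (rect_int g a (a + w) c (c + h)) <= 2 * e * (w + h).
Proof.
move=> w0 h0 e0 cg H.
have X y : c <= y <= c + h ->
  ex_RInt (fun x => Re (g (x, y))) a (a + w).
  by move=> Hy; apply: (ex_RInt_hslice g a (a + w) c (c + h)) => //; lra.
have Y x : a <= x <= a + w -> ex_RInt (fun y => Im (g (x, y))) c (c + h).
  by move=> Hx; apply: (ex_RInt_vslice g a (a + w) c (c + h)) => //; lra.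
have D1 : RInt (fun x => Re (g (x, c))) a (a + w) - RInt (fun x => Re (g (x, c + h))) a (a + w)
  = RInt (fun x => Re (g (x, c)) - Re (g (x, c + h))) a (a + w).
  by rewrite RInt_minus //; apply: X; lra.
have D2 : RInt (fun y => Im (g (a + w, y))) c (c + h) - RInt (fun y => Im (g (a, y))) c (c + h)
  = RInt (fun y => Im (g (a + w, y)) - Im (g (a, y))) c (c + h).
  by rewrite RInt_minus //; apply: Y; lra.
have B1 : Rabs (RInt (fun x => Re (g (x, c)) - Re (g (x, c + h))) a (a + w)
    - (a + w - a) * (Im l * h)) <= (a + w - a) * (2 * e).
  apply: RInt_near_const; first lra.
    by apply: (ex_RInt_minus (V := R_NormedModule)); apply: X; lra.
  move=> x Hx.
  have := Rle_trans _ _ _ (re_le_Cmod _) (H x c Hx ltac:(lra)).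
  have := Rle_trans _ _ _ (re_le_Cmod _) (H x (c + h) Hx ltac:(lra)).
  rewrite !Re_minus !Re_mult !Re_minus !Im_minus /=.
  move=> /Rabs_le_between A1 /Rabs_le_between A2; apply/Rabs_le_between; lra.
have B2 : Rabs (RInt (fun y => Im (g (a + w, y)) - Im (g (a, y))) c (c + h)
    - (c + h - c) * (Im l * w)) <= (c + h - c) * (2 * e).
  apply: RInt_near_const; first lra.
    by apply: (ex_RInt_minus (V := R_NormedModule)); apply: Y; lra.
  move=> y Hy.
  have := Rle_trans _ _ _ (Im_le_Cmod _) (H a y ltac:(lra) Hy).
  have := Rle_trans _ _ _ (Im_le_Cmod _) (H (a + w) y ltac:(lra) Hy).
  rewrite !Im_minus !Im_mult !Re_minus !Im_minus /=.
  move=> /Rabs_le_between A1 /Rabs_le_between A2; apply/Rabs_le_between; lra.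
rewrite /rect_int D1 D2.
move: B1 B2 => /Rabs_le_between B1 /Rabs_le_between B2; apply/Rabs_le_between; lra.
Qed.

(** Repeated quartering keeps at least [4 ^ -n] of the integral, while differentiability at the
    common point of the nested rectangles makes the integral over the [n]-th one [o(4 ^ -n)]. *)
Lemma goursat g a b c d : a <= b -> c <= d ->
  (forall x y, a <= x <= b -> c <= y <= d -> cdiff g (x, y)) ->
  rect_int g a b c d = 0.
Proof.
move=> ab cd dg.
set w0 := b - a; set h0 := d - c.
have w00 : 0 <= w0 by rewrite /w0; lra.
have h00 : 0 <= h0 by rewrite /h0; lra.
have cg : rect_cont g a b c d by move=> x y Hx Hy; apply: cdiff_ccont; exact: dg.
pose inside (s : R * R) n := a <= s.1 /\ s.1 + w0 / 2 ^ n <= b /\ c <= s.2 /\ s.2 + h0 / 2 ^ n <= d.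
pose J (s : R * R) n := Rabs (rect_int g s.1 (s.1 + w0 / 2 ^ n) s.2 (s.2 + h0 / 2 ^ n)).
have p2 n : 0 < 2 ^ n by apply: pow_lt; lra.
have wn n : 0 <= w0 / 2 ^ n by apply: Rdiv_le_0_compat.
have hn n : 0 <= h0 / 2 ^ n by apply: Rdiv_le_0_compat.
have half u n : u / 2 ^ n.+1 = u / 2 ^ n / 2.
  by rewrite /= ; field; have := p2 n; lra.
(* The choice function [nxt] has to be total, so the existence claim is made for every [s] with its
   guarantees conditional on [inside s n]. *)
have step n (s : R * R) : exists s' : R * R, inside s n ->
   (s'.1 = s.1 \/ s'.1 = s.1 + w0 / 2 ^ n.+1) /\
   (s'.2 = s.2 \/ s'.2 = s.2 + h0 / 2 ^ n.+1) /\ J s n <= 4 * J s' n.+1.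
  case: (classic (inside s n)) => [Hs|nHs]; last by exists s.
  have [|a' [c' [Ha [Hc HJ]]]] := rect_int_quarter g s.1 s.2 _ _ (wn n) (hn n).
    case: Hs => [H1 [H2 [H3 H4]]]; exact: (rect_cont_sub _ a b c d).
  by exists (a', c'); rewrite /J !half.
pose nxt n s := proj1_sig (constructive_indefinite_description _ (step n s)).
have Hnxt n s := proj2_sig (constructive_indefinite_description _ (step n s)).
pose fix S (n : nat) : R * R := if n is k.+1 then nxt k (S k) else (a, c).
have inS n : inside (S n) n.
  elim: n => [|n IH]; first by rewrite /inside /= /w0 /h0; lra.
  have [H1 [H2 _]] := Hnxt n (S n) IH; rewrite -/(nxt n (S n)) -/(S n.+1) in H1 H2.
  case: IH => [I1 [I2 [I3 I4]]]; rewrite /inside !half.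
  move: (wn n) (hn n) H1 H2; rewrite !half => ? ? H1 H2; case: H1; case: H2; lra.
have St n : [/\ (S n).1 <= (S n.+1).1, (S n).2 <= (S n.+1).2,
   (S n.+1).1 + w0 / 2 ^ n.+1 <= (S n).1 + w0 / 2 ^ n &
   (S n.+1).2 + h0 / 2 ^ n.+1 <= (S n).2 + h0 / 2 ^ n].
  have [H1 [H2 _]] := Hnxt n (S n) (inS n); rewrite -/(nxt n (S n)) -/(S n.+1) in H1 H2.
  move: (wn n) (hn n) H1 H2; rewrite !half => ? ? H1 H2.
  by split; case: H1; case: H2; lra.
have JS n : J (S 0%N) 0%N <= 4 ^ n * J (S n) n.
  elim: n => [|n IH]; first by rewrite /=; lra.
  have [_ [_ H]] := Hnxt n (S n) (inS n); rewrite -/(nxt n (S n)) -/(S n.+1) in H.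
  apply: Rle_trans IH _; rewrite [4 ^ n.+1]/=.
  have : 0 < 4 ^ n by apply: pow_lt; lra.
  nra.
have mono m n : (m <= n)%N -> [/\ (S m).1 <= (S n).1, (S m).2 <= (S n).2,
   (S n).1 + w0 / 2 ^ n <= (S m).1 + w0 / 2 ^ m &
   (S n).2 + h0 / 2 ^ n <= (S m).2 + h0 / 2 ^ m].
  elim: n => [|n IH]; first by rewrite leqn0 => /eqP ->; split; lra.
  rewrite leq_eqVlt => /orP[/eqP -> | /IH [I1 I2 I3 I4]]; first by split; lra.
  by have [K1 K2 K3 K4] := St n; split; lra.
(* Every lower-left corner is bounded by every upper-right one, so the suprema of the lower-left
   coordinates give a point of all the rectangles. *)
have cross m n : (S m).1 <= (S n).1 + w0 / 2 ^ n /\ (S m).2 <= (S n).2 + h0 / 2 ^ n.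
  have := wn m; have := hn m; have := wn n; have := hn n.
  by case: (leqP m n) => [/mono|/ltnW/mono] [K1 K2 K3 K4]; lra.
have [x0 [X1 X2]] := completeness (fun x => exists n, (S n).1 = x)
  (ex_intro _ b (fun x H => let: ex_intro n E := H in eq_ind _ (fun x => x <= b)
     (Rle_trans _ _ _ (cross n 0%N).1 (inS 0%N).2.1) _ E)) (ex_intro _ _ (ex_intro _ 0%N erefl)).
have [y0 [Y1 Y2]] := completeness (fun x => exists n, (S n).2 = x)
  (ex_intro _ d (fun x H => let: ex_intro n E := H in eq_ind _ (fun x => x <= d)
     (Rle_trans _ _ _ (cross n 0%N).2 (inS 0%N).2.2.2) _ E)) (ex_intro _ _ (ex_intro _ 0%N erefl)).
have Hx n : (S n).1 <= x0 <= (S n).1 + w0 / 2 ^ n.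
  split; first by apply: X1; exists n.
  by apply: X2 => x [m <-]; exact: (cross m n).1.
have Hy n : (S n).2 <= y0 <= (S n).2 + h0 / 2 ^ n.
  split; first by apply: Y1; exists n.
  by apply: Y2 => x [m <-]; exact: (cross m n).2.
have dz : cdiff g (x0, y0).
  have := inS 0%N; have := Hx 0%N; have := Hy 0%N; rewrite /inside => K1 K2 K3.
  by apply: dg; lra.
case: dz => [phi [cp [d1 [d10 E]]]].
set M := w0 + h0.
have M0 : 0 <= M by rewrite /M; lra.
(* The factor [4 ^ n] is compensated by two factors [M / 2 ^ n], one from the Taylor remainder and
   one from the perimeter, leaving a bound free of [n]. *)
have key e : 0 < e -> J (S 0%N) 0%N <= e * (2 * M * M).
  move=> e0.
  have [d2 [d20 H2]] := cp e e0.
  have dm : 0 < Rmin d1 d2 by apply: Rmin_pos.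
  have [n Hn] : exists n, M / 2 ^ n < Rmin d1 d2.
    have [N HN] := pow_lt_1_zero (/ 2) ltac:(rewrite Rabs_pos_eq; lra) (Rmin d1 d2 / (M + 1))
      ltac:(apply: Rdiv_lt_0_compat; lra).
    exists N; have := HN N (Nat.le_refl _).
    have i2 : 0 < (/ 2) ^ N by apply: pow_lt; lra.
    rewrite Rabs_pos_eq; last lra.
    move=> K; rewrite /Rdiv -pow_inv.
    have : (/ 2) ^ N * (M + 1) < Rmin d1 d2.
      have -> : Rmin d1 d2 = Rmin d1 d2 / (M + 1) * (M + 1) by field; lra.
      by apply: Rmult_lt_compat_r => //; lra.
    nra.
  have L1 := Rmin_l d1 d2; have L2 := Rmin_r d1 d2.
  have Mn : M / 2 ^ n = w0 / 2 ^ n + h0 / 2 ^ n by rewrite /M; field; have := p2 n; lra.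
  have B : J (S n) n <= 2 * (e * (M / 2 ^ n)) * (w0 / 2 ^ n + h0 / 2 ^ n).
    apply: (rect_int_small g _ _ _ _ (x0, y0) (phi (x0, y0))) => //.
    - by apply: Rmult_le_pos; [lra | rewrite Mn; have := wn n; have := hn n; lra].
    - by case: (inS n) => [H1 [H3 [H4 H5]]]; exact: (rect_cont_sub _ a b c d).
    move=> x y Qx Qy.
    have Q : Cmod ((x, y) - (x0, y0))%C <= M / 2 ^ n.
      apply: Rle_trans (Cmod_le_ReIm _) _; rewrite Re_minus Im_minus /= Mn.
      have := Hx n; have := Hy n => P1 P2.
      by apply: Rplus_le_compat; apply/Rabs_le_between; lra.
    rewrite (E (x, y)); last lra.
    have -> : (g (x0, y0) + phi (x, y) * ((x, y) - (x0, y0)) - g (x0, y0) -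
       phi (x0, y0) * ((x, y) - (x0, y0)) = (phi (x, y) - phi (x0, y0)) * ((x, y) - (x0, y0)))%C by ring.
    rewrite Cmod_mult; apply: Rmult_le_compat; try exact: Cmod_ge_0; last by [].
    by apply: Rlt_le; apply: H2; lra.
  apply: Rle_trans (JS n) _.
  apply: (Rle_trans _ (4 ^ n * (2 * (e * (M / 2 ^ n)) * (w0 / 2 ^ n + h0 / 2 ^ n)))).
    by apply: Rmult_le_compat_l => //; apply: Rlt_le; apply: pow_lt; lra.
  apply: Req_le; rewrite -Mn.
  have -> : (4 = 2 * 2)%R by lra.
  rewrite Rpow_mult_distr; field; have := p2 n; lra.
have EJ : J (S 0%N) 0%N = Rabs (rect_int g a b c d).
  rewrite /J /= /w0 /h0; congr Rabs; congr rect_int; lra.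
apply: NNPP => nz.
have J0 : 0 < Rabs (rect_int g a b c d) by apply: Rabs_pos_lt.
have := key (Rabs (rect_int g a b c d) / (2 * (2 * M * M + 1))).
rewrite EJ => K.
have q0 : 0 < 2 * M * M + 1 by nra.
have {}K := K ltac:(apply: Rdiv_lt_0_compat; lra).
have : Rabs (rect_int g a b c d) / (2 * (2 * M * M + 1)) * (2 * M * M) <= Rabs (rect_int g a b c d) / 2.
  have -> : Rabs (rect_int g a b c d) / (2 * (2 * M * M + 1)) * (2 * M * M)
     = Rabs (rect_int g a b c d) / 2 * ((2 * M * M) / (2 * M * M + 1)) by field; lra.
  have : (2 * M * M) / (2 * M * M + 1) <= 1.
    apply: (Rmult_le_reg_r (2 * M * M + 1)) => //.
    by rewrite /Rdiv Rmult_assoc Rinv_l; lra.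
  nra.
lra.
Qed.

(** * Mean values and Schwarz' lemma *)

Definition cexp (s : C) : C := (exp (Re s) * cos (Im s), exp (Re s) * sin (Im s)).

Lemma Cmod_cexp s : Cmod (cexp s) = exp (Re s).
Proof.
have p := exp_pos (Re s).
apply: Rsqr_inj; [exact: Cmod_ge_0 | lra |].
rewrite /Rsqr Cmod_sqr /=.
have := sin2_cos2 (Im s); rewrite /Rsqr => H; nra.
Qed.

Lemma cexp_plus s t : cexp (s + t) = (cexp s * cexp t)%C.
Proof.
rewrite /cexp Re_plus Im_plus exp_plus cos_plus sin_plus.
by apply: Ceq; rewrite ?Re_mult ?Im_mult /=; ring.
Qed.

Lemma cexp_periodic x : cexp (x, 2 * PI) = cexp (x, 0).
Proof. by rewrite /cexp /= cos_2PI sin_2PI cos_0 sin_0. Qed.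

Lemma derivable_pt_lim0 f l e : derivable_pt_lim f 0 l -> 0 < e ->
  exists d, 0 < d /\ forall h, Rabs h < d -> Rabs (f h - f 0 - l * h) <= e * Rabs h.
Proof.
move=> H e0; have [d Hd] := H e e0; exists d; split; first exact: cond_pos.
move=> h Hh; case: (Req_dec h 0) => [-> | nz].
  by rewrite Rmult_0_r !Rminus_diag Rabs_R0; lra.
have := Hd h nz Hh; rewrite Rplus_0_l => K.
have -> : f h - f 0 - l * h = ((f h - f 0) / h - l) * h by field.
by rewrite Rabs_mult; apply: Rmult_le_compat_r; [exact: Rabs_pos | lra].
Qed.

Lemma cexp_near0 e : 0 < e -> exists d, 0 < d /\ forall h, Cmod h < d ->
  Cmod (cexp h - 1 - h)%C <= e * Cmod h.
Proof.
(* The four error terms below are at most [k], [3 k], [3 k] and [k] times [Cmod h], in total [8 k].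
   The cap [k <= 1] gives [|exp x - 1| <= 2 |x|], and [|x| < k / 2] then makes this at most [k]. *)
move=> e0; pose k := Rmin (e / 8) 1.
have k0 : 0 < k by apply: Rmin_pos; lra.
have k1 : k <= 1 := Rmin_r _ _; have ke : k <= e / 8 := Rmin_l _ _.
have De := derivable_pt_lim_exp 0; rewrite exp_0 in De.
have Dc := derivable_pt_lim_cos 0; rewrite sin_0 Ropp_0 in Dc.
have Ds := derivable_pt_lim_sin 0; rewrite cos_0 in Ds.
have [d1 [p1 H1]] := derivable_pt_lim0 exp 1 k
  De k0.
have [d2 [p2 H2]] := derivable_pt_lim0 cos 0 k
  Dc k0.
have [d3 [p3 H3]] := derivable_pt_lim0 sin 1 k
  Ds k0.
exists (Rmin (Rmin d1 d2) (Rmin d3 (k / 2))); split.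
  by repeat apply: Rmin_pos => //; lra.
move=> h Hh.
have A1 := Rmin_l (Rmin d1 d2) (Rmin d3 (k / 2)); have A2 := Rmin_r (Rmin d1 d2) (Rmin d3 (k / 2)).
have A3 := Rmin_l d1 d2; have A4 := Rmin_r d1 d2; have A5 := Rmin_l d3 (k / 2); have A6 := Rmin_r d3 (k / 2).
have R1 := re_le_Cmod h; have R2 := Im_le_Cmod h.
set x := Re h in R1; set y := Im h in R2.
have {H1}X := H1 x ltac:(lra); have {H2}Yc := H2 y ltac:(lra); have {H3}Ys := H3 y ltac:(lra).
rewrite exp_0 in X; rewrite cos_0 Rmult_0_l Rminus_0_r in Yc; rewrite sin_0 Rminus_0_r in Ys.
have x0 := Rabs_pos x; have y0 := Rabs_pos y.
have E1 : Rabs (exp x - 1) <= 2 * Rabs x.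
  have -> : exp x - 1 = (exp x - 1 - 1 * x) + x by ring.
  apply: Rle_trans (Rabs_triang _ _) _; nra.
have E2 : exp x <= 3.
  by move: E1 => /Rabs_le_between; lra.
have E3 := exp_pos x.
apply: Rle_trans (Cmod_le_ReIm _) _.
have -> : Re (cexp h - 1 - h)%C = (exp x - 1 - 1 * x) + exp x * (cos y - 1).
  by rewrite !Re_minus /= -/x -/y; ring.
have -> : Im (cexp h - 1 - h)%C = exp x * (sin y - 1 * y) + (exp x - 1) * y.
  by rewrite !Im_minus /= -/x -/y; ring.
have := Rabs_triang (exp x - 1 - 1 * x) (exp x * (cos y - 1)).
have := Rabs_triang (exp x * (sin y - 1 * y)) ((exp x - 1) * y).
rewrite !Rabs_mult (Rabs_pos_eq (exp x)); last lra.
have F1 : exp x * Rabs (cos y - 1) <= 3 * (k * Rabs y).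
  by apply: Rmult_le_compat; try lra; exact: Rabs_pos.
have F2 : exp x * Rabs (sin y - 1 * y) <= 3 * (k * Rabs y).
  by apply: Rmult_le_compat; try lra; exact: Rabs_pos.
have F3 : Rabs (exp x - 1) * Rabs y <= k * Rabs y.
  by apply: Rmult_le_compat_r; lra.
have F4 : k * Rabs x <= k * Cmod h by apply: Rmult_le_compat_l; lra.
have F5 : k * Rabs y <= k * Cmod h by apply: Rmult_le_compat_l; lra.
have F6 : k * Cmod h <= e / 8 * Cmod h by apply: Rmult_le_compat_r; [exact: Cmod_ge_0|lra].
lra.
Qed.

Lemma cdiff_cexp z : cdiff cexp z.
Proof.
apply: (cdiff_estimate _ _ (cexp z)) => e e0.
have m0 : 0 < Cmod (cexp z) by rewrite Cmod_cexp; exact: exp_pos.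
have [d [d0 H]] := cexp_near0 (e / Cmod (cexp z)) (Rdiv_lt_0_compat _ _ e0 m0).
exists d; split => // w /H K.
have {1}-> : (w = z + (w - z))%C by ring.
rewrite cexp_plus.
have -> : (cexp z * cexp (w - z) - cexp z - cexp z * (w - z) = cexp z * (cexp (w - z) - 1 - (w - z)))%C by ring.
rewrite Cmod_mult.
have -> : e * Cmod (w - z)%C = Cmod (cexp z) * (e / Cmod (cexp z) * Cmod (w - z)%C) by field; lra.
by apply: Rmult_le_compat_l K; lra.
Qed.

(* The substitution [z = z0 + cexp s] maps rectangles of height [2 PI] to annuli
   around [z0]; by periodicity the horizontal sides of Goursat's rectangle
   cancel, so the mean over circles does not depend on the radius.  Only
   continuity is needed at the centre itself. *)
Lemma circle_mean_Im q z0 rho : ccont q z0 ->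
  (forall z, 0 < Cmod (z - z0)%C < rho -> cdiff q z) ->
  forall x, exp x < rho ->
  ex_RInt (fun th => Im (q (z0 + cexp (x, th))%C)) 0 (2 * PI) /\
  RInt (fun th => Im (q (z0 + cexp (x, th))%C)) 0 (2 * PI) = 2 * PI * Im (q z0).
Proof.
move=> cq dq x Hx.
have PI0 := PI_RGT_0.
pose g s := q (z0 + cexp s)%C.
have dg s : exp (Re s) < rho -> cdiff g s.
  move=> Hs; apply: (cdiff_comp q (fun s => (z0 + cexp s)%C)).
    by apply: cdiff_plus; [exact: cdiff_const | exact: cdiff_cexp].
  apply: dq; rewrite (_ : (z0 + cexp s - z0 = cexp s)%C); last by ring.
  by rewrite Cmod_cexp; split => //; exact: exp_pos.
have I a : exp a < rho -> ex_RInt (fun th => Im (g (a, th))) 0 (2 * PI).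
  move=> Ha; apply: (ex_RInt_vslice g a a 0 (2 * PI)); [lra | lra |].
  move=> x' y Hx' _; apply: cdiff_ccont; apply: dg => /=.
  by have -> : x' = a by lra.
split; first exact: I.
have const a : a <= x -> RInt (fun th => Im (g (a, th))) 0 (2 * PI) =
                       RInt (fun th => Im (g (x, th))) 0 (2 * PI).
  move=> ax.
  have := goursat g a x 0 (2 * PI) ax ltac:(lra).
  have H : forall x' y, a <= x' <= x -> 0 <= y <= 2 * PI -> cdiff g (x', y).
    move=> x' y Hx' _; apply: dg => /=.
    apply: Rle_lt_trans Hx.
    by case: (Req_dec x' x) => [-> | N]; [lra | apply: Rlt_le; apply: exp_increasing; lra].
  move=> /(_ H); rewrite /rect_int.
  have -> : (fun x' => Re (g (x', 2 * PI))) = (fun x' => Re (g (x', 0))).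
    by apply: functional_extensionality => x'; rewrite /g cexp_periodic.
  lra.
apply: NNPP => nE.
pose D := RInt (fun th => Im (g (x, th))) 0 (2 * PI) - 2 * PI * Im (q z0).
have D0 : 0 < Rabs D by apply: Rabs_pos_lt; rewrite /D => K; apply: nE; rewrite -/(g _); exact: Rminus_diag_uniq.
(* Integrated over an interval of length [2 * PI], this tolerance gives only half of [Rabs D], which
   contradicts [D] being nonzero. *)
have [d [d0 H]] := cq (Rabs D / (4 * PI)) ltac:(apply: Rdiv_lt_0_compat; lra).
pose a := Rmin x (ln (d / 2)).
have ax : a <= x := Rmin_l _ _.
have ea : exp a < d.
  apply: (Rle_lt_trans _ (exp (ln (d / 2)))).
    by case: (Rmin_r x (ln (d / 2))) => [K|K]; rewrite -/a in K; [apply: Rlt_le; exact: exp_increasing | rewrite K; lra].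
  rewrite exp_ln; lra.
have er : exp a < rho.
  by apply: Rle_lt_trans Hx; case: ax => [K|->]; [apply: Rlt_le; exact: exp_increasing | lra].
have := RInt_near_const (fun th => Im (g (a, th))) 0 (2 * PI) (Im (q z0)) (Rabs D / (4 * PI)) ltac:(lra) (I a er).
rewrite const // Rminus_0_r -/D.
have B : forall x0, 0 <= x0 <= 2 * PI -> Rabs (Im (g (a, x0)) - Im (q z0)) <= Rabs D / (4 * PI).
  move=> th _; rewrite -Im_minus; apply: Rle_trans (Im_le_Cmod _) _; apply: Rlt_le; apply: H.
  rewrite (_ : (z0 + cexp (a, th) - z0 = cexp (a, th))%C); last by ring.
  by rewrite Cmod_cexp.
move=> /(_ B).
have -> : 2 * PI * (Rabs D / (4 * PI)) = Rabs D / 2 by field; lra.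
rewrite -/(g) => K.
have : Rabs D <= Rabs D / 2 by exact: K.
lra.
Qed.

(** The mean of [Re k] over the circle is [Re (k z0)], which is 0, so [Re k] cannot stay below
    [- eta]. Multiplication by [Ci] turns real parts into the imaginary parts that [circle_mean_Im]
    treats. *)
Lemma circle_Re_not_neg k z0 rho eta : ccont k z0 ->
  (forall z, 0 < Cmod (z - z0)%C < rho -> cdiff k z) -> k z0 = 0 -> 0 < eta ->
  forall r, 0 < r < rho -> exists z, Cmod (z - z0)%C = r /\ - eta < Re (k z).
Proof.
move=> ck dk k0 eta0 r [r0 Hr].
have PI0 := PI_RGT_0.
have er : exp (ln r) = r by rewrite exp_ln.
have [I E] := circle_mean_Im (fun z => Ci * k z)%C z0 rho
  (ccont_mult _ _ _ (ccont_const _ _) ck)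
  (fun z Hz => cdiff_mult _ _ _ (cdiff_const _ _) (dk z Hz)) (ln r) ltac:(rewrite er; lra).
have ImRe z : Im (Ci * z)%C = Re z by rewrite Im_mult /=; ring.
rewrite k0 Cmult_0_r [Im 0]/= Rmult_0_r in E.
apply: NNPP => nH.
have : RInt (fun th => Im (Ci * k (z0 + cexp (ln r, th)))%C) 0 (2 * PI) <= RInt (fun _ => - eta) 0 (2 * PI).
  apply: RInt_le => //; first lra.
    exact: ex_RInt_const.
  move=> th _; rewrite ImRe; apply: Rnot_lt_le => K; apply: nH.
  exists (z0 + cexp (ln r, th))%C; split => //.
  by rewrite (_ : (z0 + cexp (ln r, th) - z0 = cexp (ln r, th))%C) ?Cmod_cexp //; ring.
rewrite E RInt_const /scal /= /mult /=; nra.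
Qed.

Lemma ccont_Cmod f z : ccont f z -> forall e, 0 < e -> exists d, 0 < d /\
  forall w, Cmod (w - z)%C < d -> Rabs (Cmod (f w) - Cmod (f z)) < e.
Proof.
move=> cf e e0; have [d [d0 H]] := cf e e0; exists d; split => // w /H K.
have := Cmod_le_dist (f w) (f z); have := Cmod_le_dist (f z) (f w).
rewrite (Cmod_minus_sym (f z)) => A1 A2; apply/Rabs_lt_between; lra.
Qed.

Lemma Rsqr_cont (x e : R) : 0 <= x -> 0 < e -> exists d, 0 < d /\
  forall y, Rabs (y - x) < d -> Rabs (y * y - x * x) < e.
Proof.
move=> x0 e0; have p : 0 < 2 * x + 1 by lra.
exists (Rmin 1 (e / (2 * x + 1))); split.
  by apply: Rmin_pos; [lra | apply: Rdiv_lt_0_compat].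
move=> y Hy; have L1 := Rmin_l 1 (e / (2 * x + 1)); have L2 := Rmin_r 1 (e / (2 * x + 1)).
have -> : y * y - x * x = (y - x) * (y + x) by ring.
rewrite Rabs_mult.
have : Rabs (y + x) <= 2 * x + 1.
  have -> : y + x = (y - x) + 2 * x by ring.
  apply: Rle_trans (Rabs_triang _ _) _; rewrite (Rabs_pos_eq (2 * x)); lra.
have : Rabs (y - x) * (2 * x + 1) < e.
  have -> : e = e / (2 * x + 1) * (2 * x + 1) by field; lra.
  by apply: Rmult_lt_compat_r => //; lra.
have := Rabs_pos (y - x); have := Rabs_pos (y + x); nra.
Qed.

(* At an interior maximum [z1] of the strictly subharmonic function
   [|q|^2 + eta |z|^2] the holomorphic function
   [2 conj(q z1) (q z - q z1) + 2 eta conj(z1) (z - z1)] would have negative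
   real part on a circle around its zero [z1]. *)
Lemma max_principle q r M : 0 < r < 1 ->
  (forall z, Cmod z < 1 -> ccont q z) ->
  (forall z : C, z <> 0 -> Cmod z < 1 -> cdiff q z) ->
  (forall z, Cmod z = r -> Cmod (q z) <= M) ->
  forall z, Cmod z <= r -> Cmod (q z) <= M.
Proof.
move=> [r0 r1] cq dq HM.
have M0 : 0 <= M.
  by apply: Rle_trans (HM (RtoC r) _); [exact: Cmod_ge_0 | rewrite Cmod_R Rabs_pos_eq //; lra].
have key eta : 0 < eta -> forall z, Cmod z <= r -> Cmod (q z) * Cmod (q z) <= M * M + eta * (r * r).
  move=> eta0.
  pose F z := Cmod (q z) * Cmod (q z) + eta * (Cmod z * Cmod z).
  have cF z : Cmod z <= r -> forall e, 0 < e -> exists d, 0 < d /\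
     forall w, Cmod (w - z)%C < d -> Rabs (F w - F z) < e.
    move=> Hz e e0.
    have [d1 [p1 H1]] := Rsqr_cont (Cmod (q z)) (e / 2) (Cmod_ge_0 _) ltac:(lra).
    have [d2 [p2 H2]] := Rsqr_cont (Cmod z) (e / 2 / eta) (Cmod_ge_0 _) ltac:(apply: Rdiv_lt_0_compat; lra).
    have [d3 [p3 H3]] := ccont_Cmod q z (cq z ltac:(lra)) d1 p1.
    have [d4 [p4 H4]] := ccont_Cmod id z (ccont_id z) d2 p2.
    exists (Rmin d3 d4); split; first exact: Rmin_pos.
    move=> w Hw; have L1 := Rmin_l d3 d4; have L2 := Rmin_r d3 d4.
    have A1 := H1 _ (H3 w ltac:(lra)); have A2 := H2 _ (H4 w ltac:(lra)).
    have -> : F w - F z = (Cmod (q w) * Cmod (q w) - Cmod (q z) * Cmod (q z)) +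
       eta * (Cmod w * Cmod w - Cmod z * Cmod z) by rewrite /F; ring.
    apply: Rle_lt_trans (Rabs_triang _ _) _.
    rewrite Rabs_mult (Rabs_pos_eq eta); last lra.
    have : eta * Rabs (Cmod w * Cmod w - Cmod z * Cmod z) < e / 2.
      have -> : e / 2 = eta * (e / 2 / eta) by field; lra.
      by apply: Rmult_lt_compat_l A2.
    lra.
  have [z1 [Hz1 Hmax]] := disc_max F r ltac:(lra) cF.
  case: (Req_dec (Cmod z1) r) => [E | N].
    move=> z Hz; have := Hmax z Hz; rewrite /F E.
    have := HM z1 E; have := Cmod_ge_0 (q z1); have := Cmod_ge_0 z.
    have := Rmult_le_pos _ _ (Rlt_le _ _ eta0) (Rle_0_sqr (Cmod z)); rewrite /Rsqr.
    nra.
  exfalso.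
  pose k z := (2 * Cconj (q z1) * (q z - q z1) + 2 * eta * Cconj z1 * (z - z1))%C.
  (* A punctured disc around [z1] inside the large disc and free of the exceptional point 0, which
     may however be [z1] itself. *)
  have [rho [rho0 Hrho]] : exists rho, 0 < rho /\ forall z, Cmod (z - z1)%C < rho -> Cmod z <= r /\ (z <> z1 -> z <> 0).
    case: (classic (z1 = 0)) => [E|nz].
      exists r; split => // z; rewrite E (_ : (z - 0 = z)%C); last by ring.
      by move=> ?; split => //; lra.
    have p1 : 0 < Cmod z1 by apply/Cmod_gt_0.
    exists (Rmin (Cmod z1) (r - Cmod z1)); split; first by apply: Rmin_pos; lra.
    move=> z Hz; have L1 := Rmin_l (Cmod z1) (r - Cmod z1); have L2 := Rmin_r (Cmod z1) (r - Cmod z1).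
    split; first by have := Cmod_le_dist z z1; lra.
    move=> _ E; have := Cmod_le_dist z1 z; rewrite {1}E Cmod_0 Cmod_minus_sym; lra.
  have ck : ccont k z1.
    apply: ccont_plus; apply: ccont_mult; try exact: ccont_const.
      by apply: ccont_plus; [apply: cq; lra | exact: ccont_const].
    by apply: ccont_plus; [exact: ccont_id | exact: ccont_const].
  have dk z : 0 < Cmod (z - z1)%C < rho -> cdiff k z.
    move=> [H1 H2]; have [H3 H4] := Hrho z H2.
    have nz : z <> z1 by move=> E; move: H1; rewrite E (_ : (z1 - z1 = 0)%C) ?Cmod_0; [lra | ring].
    apply: cdiff_plus; apply: cdiff_mult; try exact: cdiff_const.
      by apply: cdiff_plus; [apply: dq; [exact: H4 | lra] | exact: cdiff_const].
    by apply: cdiff_plus; [exact: cdiff_id | exact: cdiff_const].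
  have kz : k z1 = 0 by rewrite /k; ring.
  (* With [q1 = q z1], [F z - F z1] equals [|q z - q1|^2 + eta |z - z1|^2 + Re (k z)]. On the circle
     of radius [rho / 2] the middle term is exactly this tolerance, so a point with [Re (k z)] above
     its negative beats the maximum. *)
  have e0 : 0 < eta * (rho / 2 * (rho / 2)) by apply: Rmult_lt_0_compat => //; nra.
  have [z [Ez Hz]] := circle_Re_not_neg k z1 rho _ ck dk kz e0 (rho / 2) ltac:(lra).
  have [Hzr _] := Hrho z ltac:(lra).
  have := Hmax z Hzr; rewrite /F !Cmod_sqr.
  move: Hz; rewrite -Ez Cmod_sqr /k !(Re_plus, Re_mult, Re_minus, Im_mult, Im_minus) /= /Re /Im.
  move: (q z).1 (q z).2 (q z1).1 (q z1).2 z.1 z.2 z1.1 z1.2 => a b c d x y u v.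
  have := Rle_0_sqr (a - c); have := Rle_0_sqr (b - d); rewrite /Rsqr; lra.
move=> z Hz; apply: Rnot_lt_le => K.
have q0 := Cmod_ge_0 (q z).
have rr : 0 < r * r by apply: Rmult_lt_0_compat.
have qq : 0 < Cmod (q z) * Cmod (q z) - M * M.
  have -> : Cmod (q z) * Cmod (q z) - M * M = (Cmod (q z) - M) * (Cmod (q z) + M) by ring.
  by apply: Rmult_lt_0_compat; lra.
have := key ((Cmod (q z) * Cmod (q z) - M * M) / (2 * (r * r))) ltac:(apply: Rdiv_lt_0_compat; lra) z Hz.
have -> : (Cmod (q z) * Cmod (q z) - M * M) / (2 * (r * r)) * (r * r) = (Cmod (q z) * Cmod (q z) - M * M) / 2 by field; lra.
lra.
Qed.

(** The quotient [f z / z], completed by the slope at 0, is at most [/ r] on the circle of radius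
    [r]; the maximum principle carries this inside, and [r] close to 1 gives the claim. *)
Lemma schwarz f : (forall z, Cmod z < 1 -> cdiff f z) ->
  (forall z, Cmod z < 1 -> Cmod (f z) <= 1) -> f 0 = 0 ->
  forall z, Cmod z < 1 -> Cmod (f z) <= Cmod z.
Proof.
move=> df f1 f0.
have [phi [cphi [d [d0 E]]]] := df 0 ltac:(rewrite Cmod_0; lra).
pose q (z : C) := if excluded_middle_informative (z = 0) then phi 0 else (f z / z)%C.
have qn (z : C) : z <> 0 -> q z = (f z / z)%C by rewrite /q; case: excluded_middle_informative.
have q0 : q 0 = phi 0 by rewrite /q; case: excluded_middle_informative.
have dq (z : C) : z <> 0 -> Cmod z < 1 -> cdiff q z.
  move=> nz Hz.
  have p0 : 0 < Cmod z by apply/Cmod_gt_0.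
  apply: (cdiff_ext_loc (fun w => f w / w)%C _ _ (Cmod z)) => //.
    move=> w Hw; rewrite qn // => Ew; move: Hw; rewrite Ew Cmod_minus_sym.
    by rewrite (_ : (z - 0 = z)%C); [lra | ring].
  by apply: cdiff_mult; [exact: df | apply: (cdiff_inv id) => //; exact: cdiff_id].
have cq z : Cmod z < 1 -> ccont q z.
  move=> Hz; case: (classic (z = 0)) => [-> | nz]; last by apply: cdiff_ccont; exact: dq.
  apply: (ccont_ext_loc phi _ _ d d0) => // w Hw.
  case: (classic (w = 0)) => [-> // | nw].
  by rewrite qn // E // f0; field.
have bound r z : 0 < r < 1 -> Cmod z <= r -> Cmod (q z) <= / r.
  move=> Hr; apply: (max_principle q r) => // w Ew.
  have nw : w <> 0 by move=> K; move: Ew; rewrite K Cmod_0; lra.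
  rewrite qn // Cmod_div // Ew -[X in _ <= X]Rmult_1_l; apply: Rmult_le_compat_r.
    by apply: Rlt_le; apply: Rinv_0_lt_compat; lra.
  by apply: f1; lra.
move=> z Hz; case: (classic (z = 0)) => [-> | nz]; first by rewrite f0; lra.
have p0 : 0 < Cmod z by apply/Cmod_gt_0.
apply: Rnot_lt_le => K.
have Eq : Cmod (q z) = Cmod (f z) / Cmod z by rewrite qn // Cmod_div.
(* If [Cmod z < Cmod (f z)], this [r < 1] is at least [Cmod z] and exceeds [Cmod z / Cmod (f z)], so
   that [/ r] is smaller than the quotient at [z]. *)
pose r := Rmax (Cmod z) ((1 + Cmod z / Cmod (f z)) / 2).
have F0 : Cmod z / Cmod (f z) < 1.
  apply: (Rmult_lt_reg_r (Cmod (f z))); first lra.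
  by rewrite /Rdiv Rmult_assoc Rinv_l; lra.
have Hr : 0 < r < 1.
  split; first by apply: Rlt_le_trans p0 (Rmax_l _ _).
  by apply: Rmax_lub_lt; lra.
have := bound r z Hr (Rmax_l _ _); rewrite Eq.
have R2 : (1 + Cmod z / Cmod (f z)) / 2 <= r := Rmax_r _ _.
have R3 : Cmod z / Cmod (f z) < r by lra.
move=> B.
have : r * (Cmod (f z) / Cmod z) <= 1.
  have <- : r * / r = 1 by field; lra.
  by apply: Rmult_le_compat_l B; lra.
have : 1 < r * (Cmod (f z) / Cmod z).
  have -> : 1 = (Cmod z / Cmod (f z)) * (Cmod (f z) / Cmod z) by field; lra.
  apply: Rmult_lt_compat_r R3; apply: Rdiv_lt_0_compat; lra.
lra.
Qed.

(* Schwarz' lemma for the Cayley transform [(h z - h 0) / (h z + conj (h 0))]. *)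
Lemma half_plane_schwarz (h : C -> C) : (forall z, Cmod z < 1 -> cdiff h z) ->
  (forall z, Cmod z < 1 -> Re (h z) < 0) ->
  forall z, Cmod z < 1 -> Cmod (h z) <= Cmod (h 0) * ((1 + Cmod z) / (1 - Cmod z)).
Proof.
move=> dh neg z Hz.
have D0 : Cmod 0 < 1 by rewrite Cmod_0; lra.
set c := h 0.
have cneg : Re c < 0 by exact: neg.
have den w : Cmod w < 1 -> (h w + Cconj c)%C <> 0.
  move=> /neg Hw K; have : Re (h w + Cconj c)%C = 0 by rewrite K.
  rewrite Re_plus Re_conj; lra.
pose f w := ((h w - c) / (h w + Cconj c))%C.
have df w : Cmod w < 1 -> cdiff f w.
  move=> Hw; apply: cdiff_mult.
    by apply: cdiff_plus; [exact: dh | exact: cdiff_const].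
  apply: (cdiff_inv (fun w => h w + Cconj c)%C); last exact: den.
  by apply: cdiff_plus; [exact: dh | exact: cdiff_const].
have f1 w : Cmod w < 1 -> Cmod (f w) <= 1.
  move=> Hw; have n := den w Hw; rewrite /f Cmod_div //.
  have p0 : 0 < Cmod (h w + Cconj c)%C by apply/Cmod_gt_0.
  apply: (Rmult_le_reg_r (Cmod (h w + Cconj c)%C)) => //.
  rewrite /Rdiv Rmult_assoc Rinv_l; last lra.
  rewrite Rmult_1_r Rmult_1_l.
  apply: Rsqr_incr_0_var; last lra.
  (* The two squares differ by [4 * Re (h w) * Re c], a product of two negative numbers. *)
  rewrite /Rsqr !Cmod_sqr !(Re_plus, Re_minus, Im_plus, Im_minus, Re_conj, Im_conj).
  have := neg w Hw; nra.
have f0 : f 0 = 0 by rewrite /f -/c; field; exact: (den 0).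
have := schwarz f df f1 f0 z Hz.
have n := den z Hz; rewrite /f Cmod_div //.
have p0 : 0 < Cmod (h z + Cconj c)%C by apply/Cmod_gt_0.
set t := Cmod z in Hz * => K.
have t0 : 0 <= t := Cmod_ge_0 _.
have {}K : Cmod (h z - c)%C <= t * Cmod (h z + Cconj c)%C.
  have -> : Cmod (h z - c)%C = Cmod (h z - c)%C / Cmod (h z + Cconj c)%C * Cmod (h z + Cconj c)%C by field; lra.
  by apply: Rmult_le_compat_r K; lra.
have := Cmod_triangle (h z) (Cconj c); rewrite Cmod_conj => T.
have := Cmod_ge_dist (h z) c => T2.
have : Cmod (h z) * (1 - t) <= Cmod c * (1 + t) by nra.
move=> F; apply: (Rmult_le_reg_r (1 - t)); first lra.
have -> : Cmod c * ((1 + t) / (1 - t)) * (1 - t) = Cmod c * (1 + t) by field; lra.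
exact: F.
Qed.

(** * Convex geometry of [C^d] *)

Lemma Rplus_associative : associative Rplus.
Proof. by move=> x y z; ring. Qed.
Lemma Cplus_associative : associative Cplus.
Proof. by move=> x y z; ring. Qed.

HB.instance Definition _ := Monoid.isComLaw.Build R 0 Rplus Rplus_associative Rplus_comm Rplus_0_l.
HB.instance Definition _ := Monoid.isComLaw.Build C (RtoC 0) Cplus Cplus_associative Cplus_comm Cplus_0_l.

Lemma Re_sum {I} (s : seq I) (F : I -> C) :
  Re (\big[Cplus/RtoC 0]_(i <- s) F i) = \big[Rplus/0]_(i <- s) Re (F i).
Proof. by apply: (big_morph Re Re_plus). Qed.

Lemma Cconj_sum {I} (s : seq I) (F : I -> C) :
  Cconj (\big[Cplus/RtoC 0]_(i <- s) F i) = \big[Cplus/RtoC 0]_(i <- s) Cconj (F i).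
Proof.
apply: (big_morph Cconj); last by apply: Ceq; rewrite ?Re_conj ?Im_conj /=; lra.
by move=> x y; apply: Ceq; rewrite !(Re_conj, Im_conj, Re_plus, Im_plus); lra.
Qed.

Lemma Csum_mulr {I} (s : seq I) (F : I -> C) (l : C) :
  (l * \big[Cplus/RtoC 0]_(i <- s) F i = \big[Cplus/RtoC 0]_(i <- s) (l * F i))%C.
Proof. by apply: (big_morph (Cmult l)) => [x y|]; ring. Qed.

Lemma Rsum_ge0 {I} (s : seq I) (F : I -> R) : (forall i, 0 <= F i) ->
  0 <= \big[Rplus/0]_(i <- s) F i.
Proof. by move=> H; apply: (big_ind (fun x => 0 <= x)) => [|x y|i _]; [lra | lra | exact: H]. Qed.

Lemma cd_ext {d} (x y : Cd d) : (forall i, x i = y i) -> x = y.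
Proof. exact: functional_extensionality. Qed.

Ltac cd_ring := apply: cd_ext => ?; rewrite /cd_add /cd_sub /cd_scal /cd_zero;
  rewrite ?(RtoC_plus, RtoC_minus, RtoC_mult, RtoC_opp); ring.

(** Its real part is the Euclidean inner product of the underlying real space, used for nearest
    points; as a complex function of [x] it is linear, so it composes with discs to holomorphic
    functions. *)
Definition herm {d} (x u : Cd d) : C := \big[Cplus/RtoC 0]_(i < d) (x i * Cconj (u i))%C.

Lemma herm_add {d} (x y u : Cd d) : herm (cd_add x y) u = (herm x u + herm y u)%C.
Proof. by rewrite /herm -big_split; apply: eq_bigr => i _ /=; rewrite /cd_add; ring. Qed.

Lemma herm_scal {d} l (x u : Cd d) : herm (cd_scal l x) u = (l * herm x u)%C.
Proof. by rewrite /herm Csum_mulr; apply: eq_bigr => i _; rewrite /cd_scal; ring. Qed.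

Lemma herm_sub {d} (x y u : Cd d) : herm (cd_sub x y) u = (herm x u - herm y u)%C.
Proof.
have -> : cd_sub x y = cd_add x (cd_scal (- (1))%C y) by cd_ring.
rewrite herm_add herm_scal; ring.
Qed.

Lemma herm_conj {d} (x u : Cd d) : herm x u = Cconj (herm u x).
Proof.
rewrite /herm Cconj_sum; apply: eq_bigr => i _.
by apply: Ceq; rewrite !(Re_conj, Im_conj, Re_mult, Im_mult); ring.
Qed.

Lemma Re_herm_sym {d} (x u : Cd d) : Re (herm x u) = Re (herm u x).
Proof. by rewrite herm_conj Re_conj. Qed.

Lemma cd_norm_ge0 {d} (x : Cd d) : 0 <= cd_norm x.
Proof. exact: sqrt_pos. Qed.

Lemma cd_norm_sqr {d} (x : Cd d) : cd_norm x * cd_norm x = Re (herm x x).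
Proof.
rewrite /cd_norm sqrt_sqrt; last by apply: Rsum_ge0 => i; exact: pow2_ge_0.
rewrite /herm Re_sum; apply: eq_bigr => i _.
rewrite Cmod2_alt Re_mult Re_conj Im_conj; ring.
Qed.

Lemma cd_norm_sqr_sub {d} (x y : Cd d) : cd_norm (cd_sub x y) * cd_norm (cd_sub x y) =
  cd_norm x * cd_norm x - 2 * Re (herm x y) + cd_norm y * cd_norm y.
Proof.
rewrite !cd_norm_sqr herm_sub Re_minus !(Re_herm_sym _ (cd_sub _ _)) !herm_sub !Re_minus.
rewrite (Re_herm_sym y x); ring.
Qed.

Lemma cd_norm_scal {d} l (x : Cd d) : cd_norm (cd_scal l x) = Cmod l * cd_norm x.
Proof.
apply: Rsqr_inj; first exact: cd_norm_ge0.
  by apply: Rmult_le_pos; [exact: Cmod_ge_0 | exact: cd_norm_ge0].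
rewrite /Rsqr cd_norm_sqr herm_scal herm_conj herm_scal.
have -> : Cmod l * cd_norm x * (Cmod l * cd_norm x) = (Cmod l * Cmod l) * (cd_norm x * cd_norm x) by ring.
rewrite cd_norm_sqr Cmod_sqr.
have E : Im (herm x x) = 0 by have := f_equal Im (herm_conj x x); rewrite Im_conj; lra.
rewrite !(Re_mult, Re_conj, Im_mult, Im_conj) E; ring.
Qed.

(** The nonnegative quadratic [|x - t u|^2] in the real variable [t] is evaluated at its minimum. *)
Lemma cauchy_schwarz {d} (x u : Cd d) : Re (herm x u) <= cd_norm x * cd_norm u.
Proof.
have X0 := cd_norm_ge0 x; have U0 := cd_norm_ge0 u.
have H t : 0 <= cd_norm x * cd_norm x - 2 * (t * Re (herm x u)) + t * t * (cd_norm u * cd_norm u).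
  have := cd_norm_sqr_sub x (cd_scal (RtoC t) u).
  rewrite cd_norm_scal Re_herm_sym herm_scal Re_mult /= -/(Re _) Re_herm_sym Cmod_R => E.
  have := Rle_0_sqr (cd_norm (cd_sub x (cd_scal (RtoC t) u))).
  rewrite /Rsqr E.
  have -> : Rabs t * cd_norm u * (Rabs t * cd_norm u) = (Rabs t * Rabs t) * (cd_norm u * cd_norm u) by ring.
  rewrite -/(Rsqr (Rabs t)) -Rsqr_abs /Rsqr; lra.
set B := Re _ in H *.
case: (Rle_lt_dec B 0) => [|B0]; first nra.
case: (Req_dec (cd_norm u) 0) => [E|N].
  (* For [u = 0] the quadratic is affine in [t] with negative slope; this [t] gives it the value
     -1. *)
  have := H ((cd_norm x * cd_norm x + 1) / (2 * B)); rewrite E.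
  have -> : 2 * ((cd_norm x * cd_norm x + 1) / (2 * B) * B) = cd_norm x * cd_norm x + 1 by field; lra.
  lra.
have U1 : 0 < cd_norm u * cd_norm u by apply: Rmult_lt_0_compat; lra.
have := H (B / (cd_norm u * cd_norm u)).
have -> : cd_norm x * cd_norm x - 2 * (B / (cd_norm u * cd_norm u) * B)
   + B / (cd_norm u * cd_norm u) * (B / (cd_norm u * cd_norm u)) * (cd_norm u * cd_norm u)
   = (cd_norm x * cd_norm x * (cd_norm u * cd_norm u) - B * B) / (cd_norm u * cd_norm u).
  by field; nra.
move=> K.
have : 0 <= (cd_norm x * cd_norm x * (cd_norm u * cd_norm u) - B * B).
  have -> : cd_norm x * cd_norm x * (cd_norm u * cd_norm u) - B * B =
   (cd_norm x * cd_norm x * (cd_norm u * cd_norm u) - B * B) / (cd_norm u * cd_norm u) * (cd_norm u * cd_norm u) by field; nra.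
  by apply: Rmult_le_pos; lra.
move=> L; apply: Rsqr_incr_0_var; last exact: Rmult_le_pos.
rewrite /Rsqr; lra.
Qed.

Lemma cd_norm_triangle {d} (x y : Cd d) : cd_norm (cd_add x y) <= cd_norm x + cd_norm y.
Proof.
apply: Rsqr_incr_0_var; last by have := cd_norm_ge0 x; have := cd_norm_ge0 y; lra.
have -> : cd_add x y = cd_sub x (cd_scal (- (1))%C y) by cd_ring.
rewrite /Rsqr cd_norm_sqr_sub cd_norm_scal Cmod_m1 Re_herm_sym herm_scal.
have -> : Re (- (1) * herm y x)%C = - Re (herm x y).
  by rewrite Re_mult (Re_herm_sym x) /=; ring.
have := cauchy_schwarz x y; lra.
Qed.

Lemma cd_norm_sub_sym {d} (x y : Cd d) : cd_norm (cd_sub x y) = cd_norm (cd_sub y x).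
Proof.
have -> : cd_sub x y = cd_scal (- (1))%C (cd_sub y x) by cd_ring.
by rewrite cd_norm_scal Cmod_m1 Rmult_1_l.
Qed.

Lemma cd_dist_sym {d} (x y : Cd d) : cd_dist x y = cd_dist y x.
Proof. exact: cd_norm_sub_sym. Qed.

Lemma cd_dist_triangle {d} (x y z : Cd d) : cd_dist x z <= cd_dist x y + cd_dist y z.
Proof.
rewrite /cd_dist; have -> : cd_sub x z = cd_add (cd_sub x y) (cd_sub y z) by cd_ring.
exact: cd_norm_triangle.
Qed.

Lemma cd_norm_le_dist {d} (x y : Cd d) : cd_norm x <= cd_norm y + cd_dist x y.
Proof.
have {1}-> : x = cd_add y (cd_sub x y) by cd_ring.
exact: cd_norm_triangle.
Qed.

Lemma cd_norm_comp {d} (x : Cd d) i : Cmod (x i) <= cd_norm x.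
Proof.
apply: Rsqr_incr_0_var; last exact: cd_norm_ge0.
rewrite /Rsqr /cd_norm sqrt_sqrt; last by apply: Rsum_ge0 => j; exact: pow2_ge_0.
rewrite (bigD1 i) //=; set S := bigop _ _ _.
have : 0 <= S.
  by apply: (big_ind (fun x => 0 <= x)) => [|a b|j _]; [lra | lra | exact: (pow2_ge_0 (Cmod (x j)))].
lra.
Qed.

Lemma cd_norm_eq0 {d} (x : Cd d) : cd_norm x = 0 -> x = cd_zero d.
Proof.
move=> H; apply: cd_ext => i; apply: Cmod_eq_0.
have := cd_norm_comp x i; have := Cmod_ge_0 (x i); lra.
Qed.

Lemma cd_norm_zero d : cd_norm (cd_zero d) = 0.
Proof.
have -> : cd_zero d = cd_scal (RtoC 0) (cd_zero d) by cd_ring.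
by rewrite cd_norm_scal Cmod_0 Rmult_0_l.
Qed.

Lemma cd_dist_refl {d} (x : Cd d) : cd_dist x x = 0.
Proof. rewrite /cd_dist (_ : cd_sub x x = cd_zero d); [exact: cd_norm_zero | cd_ring]. Qed.

Lemma cd_norm_le_sum {d} (x : Cd d) : cd_norm x <= \big[Rplus/0]_(i < d) Cmod (x i).
Proof.
have S0 : 0 <= \big[Rplus/0]_(i < d) Cmod (x i) by apply: Rsum_ge0 => i; exact: Cmod_ge_0.
rewrite -[X in _ <= X]sqrt_Rsqr //; apply: sqrt_le_1_alt.
suff [//] : \big[Rplus/0]_(i < d) (Cmod (x i) ^ 2) <= Rsqr (\big[Rplus/0]_(i < d) Cmod (x i)) /\
   0 <= \big[Rplus/0]_(i < d) Cmod (x i).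
apply: (big_ind2 (fun a b => a <= Rsqr b /\ 0 <= b)); rewrite /Rsqr.
- by split; lra.
- by move=> a1 b1 a2 b2 [A1 B1] [A2 B2]; split; nra.
- by move=> i _; split; [rewrite /=; lra | exact: Cmod_ge_0].
Qed.

Definition cd_tendsto {d} (u : nat -> Cd d) (l : Cd d) : Prop :=
  forall e, 0 < e -> exists N, forall n, (N <= n)%N -> cd_dist (u n) l < e.

Lemma cd_tendsto_comp {d} (u : nat -> Cd d) (l : Cd d) :
  (forall i, ctendsto (fun n => u n i) (l i)) -> cd_tendsto u l.
Proof.
move=> H e e0.
suff [N HN] : exists N, forall n, (N <= n)%N -> \big[Rplus/0]_(i < d) Cmod (u n i - l i)%C < e.
  by exists N => n /HN; apply: Rle_lt_trans; exact: cd_norm_le_sum.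
elim: (index_enum _) e e0 => [|i s IH] e e0.
  by exists 0%N => n _; rewrite big_nil.
have [N1 H1] := IH (e / 2) ltac:(lra); have [N2 H2] := H i (e / 2) ltac:(lra).
exists (maxn N1 N2) => n; rewrite geq_max big_cons => /andP[/H1 K1 /H2 K2] /=.
have <- : e / 2 + e / 2 = e by lra.
exact: Rplus_lt_compat.
Qed.

Lemma cd_cluster {d} (u : nat -> Cd d) M : (forall n, cd_norm (u n) <= M) ->
  exists (phi : nat -> nat) l, (forall n, (n <= phi n)%N) /\ cd_tendsto (fun n => u (phi n)) l.
Proof.
move=> HM.
suff [phi [l [P L]]] : exists (phi : nat -> nat) (l : Cd d), (forall n, (n <= phi n)%N) /\
    forall i, i \in index_enum 'I_d -> ctendsto (fun n => u (phi n) i) (l i).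
  by exists phi, l; split => //; apply: cd_tendsto_comp => i; apply: L; rewrite mem_index_enum.
elim: (index_enum _) => [|i s [phi [l [P L]]]].
  by exists id, (u 0%N).
have [psi [li [P2 L2]]] := complex_cluster (fun n => u (phi n) i) M
  (fun n => Rle_trans _ _ _ (cd_norm_comp _ _) (HM _)).
exists (fun n => phi (psi n)), (fun j => if j == i then li else l j); split.
  by move=> n; exact: leq_trans (P2 n) (P _).
move=> j; rewrite in_cons; case: eqP => [-> _ // | _ /= js].
exact: (ctendsto_sub _ _ psi P2 (L j js)).
Qed.

(** * Segments, interiors and separation of convex sets *)

Definition cd_seg {d} (a y : Cd d) (t : R) : Cd d := cd_add a (cd_scal (RtoC t) (cd_sub y a)).

Lemma cd_segE {d} (a y : Cd d) t : cd_seg a y t =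
  cd_add (cd_scal (1 - RtoC t)%C a) (cd_scal (RtoC t) y).
Proof. rewrite /cd_seg; cd_ring. Qed.

Lemma cd_closure_sub {d} (A : cd_set d) x : A x -> cd_closure A x.
Proof. by move=> Ax e e0; exists x; rewrite cd_dist_refl. Qed.

Lemma cd_closure_limit {d} (A : cd_set d) u l : (forall n, cd_closure A (u n)) ->
  cd_tendsto u l -> cd_closure A l.
Proof.
move=> HA Hu e e0; have [N /(_ N (leqnn N)) H1] := Hu (e / 2) ltac:(lra).
have [y [Ay Hy]] := HA N (e / 2) ltac:(lra); exists y; split => //.
have := cd_dist_triangle l (u N) y; rewrite (cd_dist_sym l (u N)); lra.
Qed.

(** An error in the far endpoint [y] is absorbed by moving [a] by [t / (1 - t)] times that error,
    which stays below [rho]. This allows a point known only approximately to be replaced by one of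
    the set. *)
Lemma seg_shift {d} (A : cd_set d) a y y' t rho : (forall x, cd_dist a x < rho -> A x) ->
  0 <= t < 1 -> cd_dist y y' < rho * (1 - t) ->
  exists a', A a' /\ cd_seg a y t = cd_seg a' y' t.
Proof.
move=> Hrho [t0 t1] Hy'.
have s0 : 0 < 1 - t by lra.
have nz : (1 - RtoC t)%C <> 0.
  by move=> /(f_equal Re); rewrite Re_minus /=; lra.
pose a' := cd_add a (cd_scal (RtoC (t / (1 - t))) (cd_sub y y')).
exists a'; split; last first.
  rewrite !cd_segE /a'; apply: cd_ext => i; rewrite /cd_add /cd_sub /cd_scal.
  rewrite RtoC_div ?RtoC_minus; last lra.
  by field; exact: nz.
apply: Hrho; rewrite /cd_dist /a'.
have -> : cd_sub a (cd_add a (cd_scal (RtoC (t / (1 - t))) (cd_sub y y'))) =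
   cd_scal (RtoC (t / (1 - t))) (cd_sub y' y) by cd_ring.
rewrite cd_norm_scal -/(cd_dist y' y) cd_dist_sym Cmod_R.
have q0 : 0 <= t / (1 - t) by apply: Rdiv_le_0_compat.
rewrite Rabs_pos_eq //.
have D0 := cd_norm_ge0 (cd_sub y y'); rewrite -/(cd_dist y y') in D0.
have -> : rho = rho * (1 - t) / (1 - t) by field; lra.
have -> : t / (1 - t) * cd_dist y y' = t * cd_dist y y' / (1 - t) by field; lra.
apply: Rmult_lt_compat_r; first exact: Rinv_0_lt_compat.
nra.
Qed.

Lemma segment_interior {d} (A : cd_set d) a y t : cd_open A -> cd_convex A ->
  A a -> cd_closure A y -> 0 <= t < 1 -> A (cd_seg a y t).
Proof.
move=> oA cA Aa Ay Ht.
have [rho [rho0 Hrho]] := oA a Aa.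
have [y' [Ay' Hy']] := Ay (rho * (1 - t)) ltac:(nra).
have [a' [Aa' ->]] := seg_shift A a y y' t rho Hrho Ht Hy'.
by apply: cA => //; lra.
Qed.

(** Prolonging the segment from [a] through [y] by less than [rho] ends in the closure, and [y] lies
    strictly before that end. The [D + 1] in the ratio covers [a = y]. *)
Lemma interior_closure {d} (A : cd_set d) a y rho : cd_open A -> cd_convex A -> A a -> 0 < rho ->
  (forall z, cd_dist y z < rho -> cd_closure A z) -> A y.
Proof.
move=> oA cA Aa rho0 H.
set D := cd_dist a y.
have D0 : 0 <= D := cd_norm_ge0 _.
pose s := rho / (2 * (D + 1)).
have s0 : 0 < s by apply: Rdiv_lt_0_compat; lra.
pose z := cd_add y (cd_scal (RtoC s) (cd_sub y a)).
have Cz : cd_closure A z.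
  apply: H; rewrite /cd_dist /z.
  have -> : cd_sub y (cd_add y (cd_scal (RtoC s) (cd_sub y a))) = cd_scal (RtoC s) (cd_sub a y) by cd_ring.
  rewrite cd_norm_scal -/(cd_dist a y) -/D Cmod_R Rabs_pos_eq; last lra.
  have -> : s * D = rho * (D / (2 * (D + 1))) by rewrite /s; field; lra.
  have : D / (2 * (D + 1)) < 1.
    apply: (Rmult_lt_reg_r (2 * (D + 1))); first lra.
    rewrite /Rdiv Rmult_assoc Rinv_l; lra.
  nra.
have -> : y = cd_seg a z (/ (1 + s)).
  rewrite cd_segE /z; apply: cd_ext => i; rewrite /cd_add /cd_sub /cd_scal.
  rewrite RtoC_inv; last lra.
  rewrite RtoC_plus; field.
  by move=> /(f_equal Re); rewrite Re_plus /=; lra.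
apply: segment_interior => //; split.
  by apply: Rlt_le; apply: Rinv_0_lt_compat; lra.
by rewrite -[X in _ < X]Rinv_1; apply: Rinv_lt_contravar; lra.
Qed.

(** [u] is [y - c] for a point [c] of the closure nearest to [y]. Minimality gives
    [Re (herm (z - c) u) <= 0], and passing from [c] to [y] subtracts [|u|^2]. *)
Lemma strict_separation {d} (A : cd_set d) y : cd_open A -> cd_convex A ->
  (exists a, A a) -> ~ cd_closure A y ->
  exists u, 0 < cd_norm u /\
    forall z, A z -> Re (herm (cd_sub z y) u) <= - (cd_norm u * cd_norm u).
Proof.
move=> oA cA [a0 Aa0] nC.
have bd : bound (fun r => exists z, A z /\ - cd_dist z y = r).
  by exists 0 => r [z [_ <-]]; have : 0 <= cd_dist z y := cd_norm_ge0 _; lra.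
have [m [Hm1 Hm2]] := completeness _ bd (ex_intro _ _ (ex_intro _ a0 (conj Aa0 erefl))).
have lb z : A z -> - m <= cd_dist z y.
  by move=> Az; have := Hm1 _ (ex_intro _ z (conj Az erefl)); lra.
have Hn n : exists z, A z /\ cd_dist z y < - m + / INR n.+1.
  apply: NNPP => H.
  have p0 : 0 < / INR n.+1 by apply: Rinv_0_lt_compat; apply: lt_0_INR; apply/ltP.
  have : m <= m - / INR n.+1.
    apply: Hm2 => r [z [Az <-]]; apply: Rnot_lt_le => K; apply: H; exists z; split => //; lra.
  lra.
pose v n := proj1_sig (constructive_indefinite_description _ (Hn n)).
have Hv n : A (v n) /\ cd_dist (v n) y < - m + / INR n.+1.
  by rewrite /v; case: constructive_indefinite_description.
have [|phi [c [P L]]] := cd_cluster v (cd_norm y + (- m + 1)).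
  move=> n; have := cd_norm_le_dist (v n) y; have := (Hv n).2.
  have : / INR n.+1 <= 1.
    rewrite -[X in _ <= X]Rinv_1; apply: Rinv_le_contravar; first lra.
    by rewrite S_INR; have := pos_INR n; lra.
  lra.
have Cc : cd_closure A c.
  by apply: (cd_closure_limit _ _ _ _ L) => n; apply: cd_closure_sub; exact: (Hv _).1.
have Hc : cd_dist c y <= - m.
  apply: Rnot_lt_le => K.
  have [N1 HN1] := L ((cd_dist c y + m) / 2) ltac:(lra).
  have [N2 HN2] := inv_INR_lt ((cd_dist c y + m) / 2) ltac:(lra).
  have := HN1 (maxn N1 N2) (leq_maxl _ _).
  have := HN2 (phi (maxn N1 N2)) (leq_trans (leq_maxr _ _) (P _)).
  have := (Hv (phi (maxn N1 N2))).2.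
  have := cd_dist_triangle c (v (phi (maxn N1 N2))) y; rewrite (cd_dist_sym c (v _)); lra.
pose u := cd_sub y c.
have u0 : 0 < cd_norm u.
  case: (cd_norm_ge0 u) => // E; case: nC.
  have -> : y = cd_add c u by rewrite /u; cd_ring.
  by rewrite (cd_norm_eq0 u) // (_ : cd_add c _ = c) //; cd_ring.
exists u; split => // z Az.
have key : Re (herm (cd_sub z c) u) <= 0.
  apply: Rnot_lt_le => K.
  set w := cd_sub z c in K.
  have W0 : 0 <= cd_norm w * cd_norm w by apply: Rmult_le_pos; exact: cd_norm_ge0.
  (* The point [c + t w] lies in [A], hence is no closer to [y] than [c]. Expanding
     [|t w - u|^2 >= |u|^2] and dividing by [t] gives the bound, which contradicts [K] for small
     [t]. *)
  have H t : 0 < t <= 1 -> 2 * Re (herm w u) <= t * (cd_norm w * cd_norm w).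
    move=> [t0 t1].
    have := segment_interior A z c (1 - t) oA cA Az Cc ltac:(lra).
    move=> /lb B.
    have : cd_dist (cd_seg z c (1 - t)) y = cd_norm (cd_sub (cd_scal (RtoC t) w) u).
      by rewrite /cd_dist /cd_seg /w /u; congr cd_norm; cd_ring.
    move=> E; rewrite E in B.
    have {B E}B : cd_norm u <= cd_norm (cd_sub (cd_scal (RtoC t) w) u).
      have Eu : cd_norm u = cd_dist c y by rewrite cd_dist_sym.
      lra.
    have := cd_norm_sqr_sub (cd_scal (RtoC t) w) u.
    rewrite cd_norm_scal herm_scal Re_mult Cmod_R Rabs_pos_eq; last lra.
    rewrite (_ : Re (RtoC t) = t) // (_ : Im (RtoC t) = 0) //.
    have : cd_norm u * cd_norm u <= cd_norm (cd_sub (cd_scal (RtoC t) w) u) * cd_norm (cd_sub (cd_scal (RtoC t) w) u).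
      by apply: Rmult_le_compat; lra.
    move=> A1 A2; apply: (Rmult_le_reg_l t) => //; nra.
  set B := Re (herm w u) in K H.
  pose t := Rmin 1 (B / (cd_norm w * cd_norm w + 1)).
  have t0 : 0 < t by apply: Rmin_pos; [lra | apply: Rdiv_lt_0_compat; lra].
  have t1 : t <= 1 := Rmin_l _ _.
  have t2 : t <= B / (cd_norm w * cd_norm w + 1) := Rmin_r _ _.
  have := H t ltac:(lra).
  have : t * (cd_norm w * cd_norm w + 1) <= B.
    have -> : B = B / (cd_norm w * cd_norm w + 1) * (cd_norm w * cd_norm w + 1) by field; lra.
    by apply: Rmult_le_compat_r => //; lra.
  lra.
have -> : cd_sub z y = cd_sub (cd_sub z c) u by rewrite /u; cd_ring.
rewrite herm_sub Re_minus -cd_norm_sqr; lra.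
Qed.

(** Compactness of the unit sphere: directions whose discs of radius [n + 1] around [p] lie in [A]
    would accumulate at the direction of a complex line inside [A]. *)
Lemma C_proper_radius {d} (A : cd_set d) p : cd_open A -> cd_convex A -> C_proper A -> A p ->
  exists R0, 0 < R0 /\ forall v, cd_norm v = 1 ->
    exists l, Cmod l <= R0 /\ ~ A (cd_add p (cd_scal l v)).
Proof.
move=> oA cA pA Ap; apply: NNPP => nH.
have Hn n : exists v, cd_norm v = 1 /\ forall l, Cmod l <= INR n.+1 -> A (cd_add p (cd_scal l v)).
  apply: NNPP => H; apply: nH; exists (INR n.+1); split; first by apply: lt_0_INR; apply/ltP.
  move=> v v1; apply: NNPP => K; apply: H; exists v; split => // l Hl.
  by apply: NNPP => K2; apply: K; exists l.
pose v n := proj1_sig (constructive_indefinite_description _ (Hn n)).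
have Hv n : cd_norm (v n) = 1 /\ forall l, Cmod l <= INR n.+1 -> A (cd_add p (cd_scal l (v n))).
  by rewrite /v; case: constructive_indefinite_description.
have [phi [w [P L]]] := cd_cluster v 1 (fun n => Req_le _ _ (Hv n).1).
apply: pA; exists p, w; split.
  move=> E; have [N /(_ N (leqnn N))] := L 1 ltac:(lra).
  have := cd_norm_le_dist (v (phi N)) w; rewrite (Hv _).1 E cd_norm_zero; lra.
move=> l.
(* The limit only yields points of the closure. Writing the point as the midpoint of [p] and
   [p + 2 l w] brings it back into the open set [A]. *)
have -> : cd_add p (cd_scal l w) = cd_seg p (cd_add p (cd_scal (2 * l)%C w)) (/ 2).
  rewrite /cd_seg; apply: cd_ext => i; rewrite /cd_add /cd_sub /cd_scal.
  rewrite RtoC_inv; last lra.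
  field.
apply: segment_interior => //; last lra.
have [m Hm] := INR_unbounded (Cmod (2 * l)%C).
apply: (cd_closure_limit _ (fun n => cd_add p (cd_scal (2 * l)%C (v (phi (maxn m n)))))).
  move=> n; apply: cd_closure_sub; apply: (Hv _).2.
  apply: Rle_trans (Rlt_le _ _ Hm) _; apply: le_INR; apply/leP.
  by apply: leqW; apply: leq_trans (P _); exact: leq_maxl.
move=> e e0.
have q0 : 0 < e / (Cmod (2 * l)%C + 1) by apply: Rdiv_lt_0_compat => //; have := Cmod_ge_0 (2 * l)%C; lra.
have [N HN] := L _ q0; exists N => n nN.
have := HN (maxn m n) (leq_trans nN (leq_maxr _ _)).
rewrite /cd_dist => K.
have -> : cd_sub (cd_add p (cd_scal (2 * l)%C (v (phi (maxn m n))))) (cd_add p (cd_scal (2 * l)%C w))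
  = cd_scal (2 * l)%C (cd_sub (v (phi (maxn m n))) w) by cd_ring.
rewrite cd_norm_scal.
have C0 := Cmod_ge_0 (2 * l)%C.
have N0 := cd_norm_ge0 (cd_sub (v (phi (maxn m n))) w).
have : (Cmod (2 * l)%C + 1) * cd_norm (cd_sub (v (phi (maxn m n))) w) < e.
  have -> : e = (Cmod (2 * l)%C + 1) * (e / (Cmod (2 * l)%C + 1)) by field; lra.
  by apply: Rmult_lt_compat_l K; lra.
nra.
Qed.

(** * Chains of discs *)

(** The function artanh: the Poincare distance from 0 to [t]. *)
Definition psi (t : R) : R := / 2 * ln ((1 + t) / (1 - t)).

Lemma psi_arg_gt0 t : 0 <= t < 1 -> 0 < (1 + t) / (1 - t).
Proof. by move=> Ht; apply: Rdiv_lt_0_compat; lra. Qed.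

Lemma exp_psi t : 0 <= t < 1 -> exp (2 * psi t) = (1 + t) / (1 - t).
Proof.
move=> Ht; rewrite /psi.
have -> : 2 * (/ 2 * ln ((1 + t) / (1 - t))) = ln ((1 + t) / (1 - t)) by field.
by rewrite exp_ln //; exact: psi_arg_gt0.
Qed.

Lemma ln_le_sub1 x : 0 < x -> ln x <= x - 1.
Proof. by move=> x0; have := exp_ineq1_le (ln x); rewrite exp_ln //; lra. Qed.

(** Lets an error proportional to [t] be counted as a fraction of the length [psi t]. *)
Lemma psi_ge_half t : 0 <= t < 1 -> t / 2 <= psi t.
Proof.
move=> Ht; have p := psi_arg_gt0 t Ht.
have := ln_le_sub1 (/ ((1 + t) / (1 - t))) (Rinv_0_lt_compat _ p).
rewrite ln_Rinv // /psi.
have -> : / ((1 + t) / (1 - t)) = 1 - 2 * t / (1 + t) by field; lra.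
have : t <= 2 * t / (1 + t).
  apply: (Rmult_le_reg_r (1 + t)); first lra.
  rewrite /Rdiv Rmult_assoc Rinv_l; nra.
lra.
Qed.

Lemma psi_ge0 t : 0 <= t < 1 -> 0 <= psi t.
Proof. move=> Ht; have := psi_ge_half t Ht; lra. Qed.

Lemma psi_le s t : 0 <= s <= t -> t < 1 -> psi s <= psi t.
Proof.
move=> Hs t1; apply: Rmult_le_compat_l; first lra.
apply: ln_le; first by apply: psi_arg_gt0; lra.
apply: (Rmult_le_reg_r ((1 - s) * (1 - t))); first by apply: Rmult_lt_0_compat; lra.
have -> : (1 + s) / (1 - s) * ((1 - s) * (1 - t)) = (1 + s) * (1 - t) by field; lra.
have -> : (1 + t) / (1 - t) * ((1 - s) * (1 - t)) = (1 + t) * (1 - s) by field; lra.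
nra.
Qed.

(** Keeps the links of a chain of bounded length uniformly away from the boundary of the disc. *)
Lemma psi_bound t r : 0 <= t < 1 -> psi t <= r -> t <= 1 - exp (- (2 * r)).
Proof.
move=> Ht H; rewrite exp_Ropp.
have E0 := exp_pos (2 * r).
have H2 : (1 + t) / (1 - t) <= exp (2 * r).
  rewrite -exp_psi //; case: H => [H | ->]; last lra.
  by apply: Rlt_le; apply: exp_increasing; lra.
have H3 : 1 <= (1 - t) * exp (2 * r).
  have : (1 + t) / (1 - t) * (1 - t) <= exp (2 * r) * (1 - t) by apply: Rmult_le_compat_r => //; lra.
  have -> : (1 + t) / (1 - t) * (1 - t) = 1 + t by field; lra.
  lra.
have : / exp (2 * r) <= 1 - t.
  apply: (Rmult_le_reg_r (exp (2 * r))) => //.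
  by rewrite Rinv_l; lra.
lra.
Qed.

(** When a disc is restricted to radius [s] and rescaled, its endpoint [t] becomes [t / s]. The
    relative increase is uniform for [t <= T] and vanishes as [s] tends to 1. *)
Lemma psi_shrink t T s : 0 <= t <= T -> T < s < 1 ->
  t / s < 1 /\ psi (t / s) <= psi t * (1 + 2 * (1 - s) / (s - T)).
Proof.
move=> Ht Hs.
have u0 : 0 <= t / s by apply: Rdiv_le_0_compat; lra.
have u1 : t / s < 1.
  by apply: (Rmult_lt_reg_r s); [lra | rewrite /Rdiv Rmult_assoc Rinv_l; lra].
split => //.
have tu : t <= t / s.
  by apply: (Rmult_le_reg_r s); [lra | rewrite /Rdiv Rmult_assoc Rinv_l; nra].
set u := t / s in u0 u1 tu *.
have p1 := psi_arg_gt0 t ltac:(lra); have p2 := psi_arg_gt0 u ltac:(lra).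
have L : psi u - psi t <= / 2 * ((1 + u) / (1 - u) * / ((1 + t) / (1 - t)) - 1).
  have := ln_le_sub1 ((1 + u) / (1 - u) * / ((1 + t) / (1 - t))) ltac:(apply: Rmult_lt_0_compat => //; exact: Rinv_0_lt_compat).
  rewrite ln_mult //; last exact: Rinv_0_lt_compat.
  rewrite ln_Rinv // /psi; lra.
have E1 : / 2 * ((1 + u) / (1 - u) * / ((1 + t) / (1 - t)) - 1) = (u - t) / ((1 - u) * (1 + t)).
  by field; repeat split; lra.
have E2 : (u - t) / ((1 - u) * (1 + t)) <= (u - t) / (1 - u).
  apply: Rmult_le_compat_l; first lra.
  apply: Rinv_le_contravar; first lra.
  nra.
have E3 : (u - t) / (1 - u) = t * ((1 - s) / (s - t)).
  by rewrite /u; field; repeat split; lra.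
have E4 : (1 - s) / (s - t) <= (1 - s) / (s - T).
  apply: Rmult_le_compat_l; first lra.
  apply: Rinv_le_contravar; lra.
have h := psi_ge_half t ltac:(lra).
have c0 : 0 <= (1 - s) / (s - T) by apply: Rdiv_le_0_compat; lra.
have E5 : t * ((1 - s) / (s - t)) <= t * ((1 - s) / (s - T)) by apply: Rmult_le_compat_l; lra.
have E6 : t * ((1 - s) / (s - T)) <= (2 * psi t) * ((1 - s) / (s - T)) by apply: Rmult_le_compat_r; lra.
have -> : psi t * (1 + 2 * (1 - s) / (s - T)) = psi t + (2 * psi t) * ((1 - s) / (s - T)) by field; lra.
lra.
Qed.

(** [|1 + conj(a) x|^2 - |x + a|^2 = (1 - |a|^2) (1 - |x|^2)]. *)
Lemma mobius_ineq (a x : C) : Cmod a < 1 -> Cmod x < 1 ->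
  Cmod (x + a)%C < Cmod (1 + Cconj a * x)%C.
Proof.
move=> Ha Hx.
apply: Rsqr_incrst_0; try exact: Cmod_ge_0.
rewrite /Rsqr.
have A1 : Cmod a * Cmod a < 1 by have := Cmod_ge_0 a; nra.
have A2 : Cmod x * Cmod x < 1 by have := Cmod_ge_0 x; nra.
rewrite !Cmod_sqr in A1 A2 *.
rewrite !(Re_plus, Im_plus, Re_mult, Im_mult, Re_conj, Im_conj).
rewrite (_ : Re (RtoC 1) = 1) // (_ : Im (RtoC 1) = 0) //.
move: (Re a) (Im a) (Re x) (Im x) A1 A2 => p q r s A1 A2.
have : 0 < (1 - (p * p + q * q)) * (1 - (r * r + s * s)) by apply: Rmult_lt_0_compat; lra.
lra.
Qed.

Lemma mobius_den (a x : C) : Cmod a < 1 -> Cmod x < 1 -> (1 + Cconj a * x)%C <> 0.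
Proof.
move=> Ha Hx; apply: Cmod_gt0_neq.
by have := mobius_ineq a x Ha Hx; have := Cmod_ge_0 (x + a)%C; lra.
Qed.

(** * Normalised discs, their chains and the Kobayashi distance *)

Definition disc_map {d} (A : cd_set d) (f : C -> Cd d) : Prop :=
  (forall i z, Cmod z < 1 -> cdiff (fun w => f w i) z) /\ (forall z, Cmod z < 1 -> A (f z)).

Lemma disc_mapP {d} (A : cd_set d) f :
  disc_map A f <-> holo_disc f /\ (forall z, unit_disc z -> A (f z)).
Proof. by split=> -[H1 H2]; split => // i z Hz; apply/ex_derive_cdiff; exact: H1. Qed.

(** A link of a Kobayashi chain after an automorphism of the disc has moved its first parameter to 0
    and its second to a real number [t >= 0], at the same Poincare distance. *)
Definition link {d} (A : cd_set d) (x y : Cd d) (t : R) : Prop :=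
  0 <= t < 1 /\ exists g, disc_map A g /\ g (RtoC 0) = x /\ g (RtoC t) = y.

(** The inductive form of [kob_chain], made for induction on the links. *)
Inductive nchain {d} (A : cd_set d) : Cd d -> Cd d -> R -> Prop :=
| nchain_nil p : nchain A p p 0
| nchain_cons p x q t r : link A p x t -> nchain A x q r -> nchain A p q (psi t + r).

Lemma disc_map_comp {d} (A : cd_set d) f m : disc_map A f ->
  (forall z, Cmod z < 1 -> cdiff m z) -> (forall z, Cmod z < 1 -> Cmod (m z) < 1) ->
  disc_map A (fun z => f (m z)).
Proof.
move=> [H1 H2] dm m1; split => [i z Hz | z Hz]; last by apply: H2; exact: m1.
by apply: (cdiff_comp (fun w => f w i) m); [exact: dm | apply: H1; exact: m1].
Qed.

(** The disc is precomposed with a rotation by [u], taking [t] to [b'], followed by the Moebius map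
    that takes 0 to [a] and [b'] to [b]. *)
Lemma link_poincare {d} (A : cd_set d) f a b : disc_map A f -> Cmod a < 1 -> Cmod b < 1 ->
  link A (f a) (f b) (Cmod (a - b)%C / Cmod (1 - Cconj a * b)%C).
Proof.
move=> Af Ha Hb.
have Hb' : Cmod (- a)%C < 1 by rewrite Cmod_opp.
have cj : Cconj (- a)%C = (- Cconj a)%C by apply: Ceq; rewrite /= ; lra.
have I := mobius_ineq _ _ Hb' Hb; have nz := mobius_den _ _ Hb' Hb.
rewrite cj in I nz.
have E : (1 + - Cconj a * b = 1 - Cconj a * b)%C by ring.
rewrite E in I nz.
have p0 : 0 < Cmod (1 - Cconj a * b)%C by apply/Cmod_gt_0.
have n0 : (1 - Cconj a * a)%C <> 0.
  have := mobius_den _ _ Hb' Ha; rewrite cj.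
  by have -> : (1 + - Cconj a * a = 1 - Cconj a * a)%C by ring.
pose b' := ((b - a) / (1 - Cconj a * b))%C.
set t := _ / _.
have Eb' : Cmod b' = t by rewrite /b' Cmod_div // Cmod_minus_sym.
have t01 : 0 <= t < 1.
  split; first by rewrite -Eb'; exact: Cmod_ge_0.
  apply: (Rmult_lt_reg_r (Cmod (1 - Cconj a * b)%C)) => //.
  rewrite /t /Rdiv Rmult_assoc Rinv_l; last lra.
  by rewrite Rmult_1_r Rmult_1_l Cmod_minus_sym.
split => //.
have [u [u1 Eu]] : exists u : C, Cmod u = 1 /\ (u * RtoC t = b')%C.
  case: (classic (b' = 0)) => [Z | NZ].
    exists 1%C; split; first exact: Cmod_1.
    by rewrite -Eb' Z Cmod_0; ring.
  have b0 : 0 < Cmod b' by apply/Cmod_gt_0.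
  have tn : RtoC (Cmod b') <> 0 by move=> /(f_equal Re) /=; lra.
  exists (b' / RtoC (Cmod b'))%C; rewrite -Eb'; split; last by field.
  by rewrite Cmod_div // Cmod_R Rabs_pos_eq; [field; lra | lra].
pose m z := ((u * z + a) / (1 + Cconj a * (u * z)))%C.
have uz z : Cmod z < 1 -> Cmod (u * z)%C < 1 by rewrite Cmod_mult u1 Rmult_1_l.
exists (fun z => f (m z)); split; last split.
- apply: disc_map_comp => // z /uz Hz.
    apply: cdiff_mult.
      apply: cdiff_plus; last exact: cdiff_const.
      by apply: cdiff_mult; [exact: cdiff_const | exact: cdiff_id].
    apply: (cdiff_inv (fun z => 1 + Cconj a * (u * z))%C); last exact: mobius_den.
    apply: cdiff_plus; first exact: cdiff_const.
    apply: cdiff_mult; first exact: cdiff_const.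
    by apply: cdiff_mult; [exact: cdiff_const | exact: cdiff_id].
  have nw := mobius_den a _ Ha Hz.
  rewrite /m Cmod_div //.
  have q0 : 0 < Cmod (1 + Cconj a * (u * z))%C by apply/Cmod_gt_0.
  apply: (Rmult_lt_reg_r (Cmod (1 + Cconj a * (u * z))%C)) => //.
  rewrite /Rdiv Rmult_assoc Rinv_l ?Rmult_1_r ?Rmult_1_l; last lra.
  exact: mobius_ineq.
- congr f; rewrite /m Cmult_0_r Cmult_0_r Cplus_0_l Cplus_0_r; field.
- congr f; rewrite /m Eu /b'; field; split => //.
  by rewrite (_ : (1 - Cconj a * b + Cconj a * (b - a) = 1 - Cconj a * a)%C) //; ring.
Qed.

Lemma poincare0 t : 0 <= t < 1 -> poincare 0 (RtoC t) = psi t.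
Proof.
move=> Ht; rewrite /poincare /psi.
have -> : Cmod (0 - t)%C = t.
  by rewrite Cmod_minus_sym (_ : (t - 0 = t)%C) ?Cmod_R ?Rabs_pos_eq //; [lra | ring].
have -> : (1 - Cconj 0 * t = 1)%C by apply: Ceq; rewrite /=; ring.
by rewrite Cmod_1 Rdiv_1_r.
Qed.

Lemma link_disc_point {d} (A : cd_set d) f z : disc_map A f -> Cmod z < 1 ->
  link A (f (RtoC 0)) (f z) (Cmod z).
Proof.
move=> Af Hz; have := link_poincare A f 0 z Af ltac:(rewrite Cmod_0; lra) Hz.
have -> : (1 - Cconj 0 * z = 1)%C by apply: Ceq; rewrite /=; ring.
by rewrite Cmod_1 Rdiv_1_r Cmod_minus_sym (_ : (z - 0 = z)%C) //; ring.
Qed.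

Lemma kob_chain_nchain {d} (A : cd_set d) p q r : kob_chain A p q r <-> nchain A p q r.
Proof.
split.
- case=> n [x [f [a [b [<- [<- [H ->]]]]]]].
  elim: n x f a b H => [|n IH] x f a b H.
    by rewrite big_geq //; exact: nchain_nil.
  rewrite big_nat_recl //.
  have [h [i [a1 [b1 [Ea Eb]]]]] := H 0%N isT.
  apply: (nchain_cons _ _ (x 1%N) _ (Cmod (a 0%N - b 0%N)%C / Cmod (1 - Cconj (a 0%N) * b 0%N)%C)).
    by rewrite -Ea -Eb; apply: link_poincare => //; apply/disc_mapP.
  apply: (IH (fun k => x k.+1) (fun k => f k.+1) (fun k => a k.+1) (fun k => b k.+1)).
  by move=> k Hk; exact: H.
- elim=> {p q r} [p | p y q t r [Ht [g [Ag [g0 gt]]]] _ [n [x [f [a [b [E0 [En [H ->]]]]]]]]].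
    exists 0%N, (fun _ => p), (fun _ _ => p), (fun _ => RtoC 0), (fun _ => RtoC 0).
    by do 3!split => //; rewrite big_geq.
  exists n.+1, (fun k => if k is j.+1 then x j else p), (fun k => if k is j.+1 then f j else g),
    (fun k => if k is j.+1 then a j else RtoC 0), (fun k => if k is j.+1 then b j else RtoC t).
  split => //; split => //; split; last first.
    by rewrite big_nat_recl // poincare0.
  case=> [_|k Hk]; last exact: H.
  have [h i] := (disc_mapP _ _).1 Ag; do 2!split => //.
  split; first by rewrite /unit_disc Cmod_0; lra.
  split; first by rewrite /unit_disc Cmod_R Rabs_pos_eq; lra.
  by rewrite E0.
Qed.

Lemma nchain_ge0 {d} (A : cd_set d) p q r : nchain A p q r -> 0 <= r.
Proof.
elim=> {p q r} [p | p x q t r [Ht _] _ IH]; first lra.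
have := psi_ge0 t Ht; lra.
Qed.

Lemma nchain_append {d} (A : cd_set d) p q q' r r' : nchain A p q r -> nchain A q q' r' ->
  nchain A p q' (r + r').
Proof.
elim=> {p q r} [p | p x q t r L _ IH] H; first by rewrite Rplus_0_l.
by rewrite Rplus_assoc; apply: nchain_cons L _; exact: IH.
Qed.

Lemma nchain_link {d} (A : cd_set d) p q t : link A p q t -> nchain A p q (psi t).
Proof. by move=> L; rewrite -[psi t]Rplus_0_r; apply: nchain_cons L _; exact: nchain_nil. Qed.

(** [real] would send an infinite bound to 0; a chain excludes plus infinity, and nonnegative
    lengths exclude minus infinity. *)
Lemma kob_dist_glb {d} (A : cd_set d) p q r0 : nchain A p q r0 ->
  is_glb_Rbar (kob_chain A p q) (Rbar.Finite (kob_dist A p q)).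
Proof.
move=> /kob_chain_nchain H0.
have := Glb_Rbar_correct (kob_chain A p q); rewrite /kob_dist.
case: (Glb_Rbar _) => [g|[H1 H2]|[H1 H2]] //=.
- by have := H1 _ H0.
- have /= := H2 (Rbar.Finite 0); case=> r /kob_chain_nchain /nchain_ge0 //=.
Qed.

Lemma kob_dist_le {d} (A : cd_set d) p q r : nchain A p q r -> kob_dist A p q <= r.
Proof. by move=> H; have [H1 _] := kob_dist_glb _ _ _ _ H; apply: H1; apply/kob_chain_nchain. Qed.

Lemma kob_dist_approx {d} (A : cd_set d) p q e : (exists r, nchain A p q r) -> 0 < e ->
  exists r, nchain A p q r /\ r < kob_dist A p q + e.
Proof.
move=> [r0 H0] e0; have [_ H2] := kob_dist_glb _ _ _ _ H0.
apply: NNPP => nH.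
have /= := H2 (Rbar.Finite (kob_dist A p q + e)); move=> K.
have : kob_dist A p q + e <= kob_dist A p q; last lra.
apply: K => r /kob_chain_nchain Hr /=; apply: Rnot_lt_le => L; apply: nH; by exists r.
Qed.

Lemma cdiff_sum {I} (s : seq I) (F : I -> C -> C) z : (forall i, cdiff (F i) z) ->
  cdiff (fun w => \big[Cplus/RtoC 0]_(i <- s) F i w) z.
Proof.
move=> H; elim: s => [|i s IH].
  have -> : (fun w => \big[Cplus/RtoC 0]_(i <- [::]) F i w) = (fun _ => RtoC 0).
    by apply: functional_extensionality => w; rewrite big_nil.
  exact: cdiff_const.
have -> : (fun w => \big[Cplus/RtoC 0]_(j <- i :: s) F j w) =
  (fun w => F i w + \big[Cplus/RtoC 0]_(j <- s) F j w)%C.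
  by apply: functional_extensionality => w; rewrite big_cons.
exact: cdiff_plus.
Qed.

Lemma disc_map_affine {d} (A B : cd_set d) F f : is_cd_affine F ->
  (forall z, A z -> B (F z)) -> disc_map A f -> disc_map B (fun z => F (f z)).
Proof.
move=> [M [b HF]] AB [H1 H2]; split => [i z Hz | z Hz]; last by apply: AB; exact: H2.
have -> : (fun w => F (f w) i) =
   (fun w => \big[Cplus/RtoC 0]_(j < d) Cmult (M i j) (f w j) + b i)%C.
  by apply: functional_extensionality => w; rewrite HF.
apply: cdiff_plus; last exact: cdiff_const.
by apply: cdiff_sum => j; apply: cdiff_mult; [exact: cdiff_const | exact: H1].
Qed.

Lemma nchain_affine {d} (A B : cd_set d) F p q r : is_cd_affine F ->
  (forall z, A z -> B (F z)) -> nchain A p q r -> nchain B (F p) (F q) r.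
Proof.
move=> aF AB; elim=> {p q r} [p | p x q t r [Ht [g [Ag [E0 Et]]]] _ IH]; first exact: nchain_nil.
apply: nchain_cons IH; split => //; exists (fun z => F (g z)).
by rewrite E0 Et; split => //; exact: (disc_map_affine A).
Qed.

Lemma affine_dilation {d} (p : Cd d) l : is_cd_affine (fun z => cd_add p (cd_scal l (cd_sub z p))).
Proof.
exists (fun i j => if i == j then l else RtoC 0), (cd_scal (1 - l)%C p) => z i.
rewrite (bigD1 i) //= eqxx big1; last first.
  by move=> j /negbTE; rewrite eq_sym => ->; ring.
rewrite /cd_add /cd_scal /cd_sub; ring.
Qed.

(* Also correct for [q = p], since then [rho / 0 = 0] makes the disc constant. *)
Lemma link_ball {d} (A : cd_set d) p q rho : (forall y, cd_dist p y < rho -> A y) ->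
  cd_dist p q < rho -> link A p q (cd_dist p q / rho).
Proof.
move=> H Hq; set D := cd_dist p q in Hq *.
have D0 : 0 <= D := cd_norm_ge0 _.
have t0 : 0 <= D / rho by apply: Rdiv_le_0_compat; lra.
split.
  split => //; apply: (Rmult_lt_reg_r rho); first lra.
  rewrite /Rdiv Rmult_assoc Rinv_l; lra.
exists (fun z => cd_add p (cd_scal (z * RtoC (rho * / D))%C (cd_sub q p))); split; first split.
- move=> i z _; rewrite /cd_add /cd_scal; apply: cdiff_plus; first exact: cdiff_const.
  apply: cdiff_mult; last exact: cdiff_const.
  by apply: cdiff_mult; [exact: cdiff_id | exact: cdiff_const].
- move=> z Hz; apply: H; rewrite /cd_dist.
  have -> : cd_sub p (cd_add p (cd_scal (z * RtoC (rho * / D))%C (cd_sub q p))) =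
     cd_scal (z * RtoC (rho * / D))%C (cd_sub p q) by cd_ring.
  rewrite cd_norm_scal -/(cd_dist p q) -/D Cmod_mult Cmod_R Rabs_mult (Rabs_pos_eq rho); last lra.
  case: (Req_dec D 0) => [-> | N]; first by rewrite Rmult_0_r; lra.
  rewrite Rabs_pos_eq; last by apply: Rlt_le; apply: Rinv_0_lt_compat; lra.
  have -> : Cmod z * (rho * / D) * D = Cmod z * rho by field.
  nra.
- split; first by cd_ring.
  case: (Req_dec D 0) => [E | N].
    have Z := cd_norm_eq0 _ E.
    have -> : q = p.
      apply: cd_ext => i; symmetry; apply: Cmod_minus_eq0.
      by have := f_equal (fun x => x i) Z; rewrite /cd_sub /cd_zero => ->; exact: Cmod_0.
    by cd_ring.
  apply: cd_ext => i; rewrite /cd_add /cd_scal /cd_sub -RtoC_mult.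
  have -> : D / rho * (rho * / D) = 1 by field; lra.
  ring.
Qed.

(** Translating the segment so that it passes through [z] moves its ends within their balls. *)
Lemma ball_seg {d} (A : cd_set d) p q rho s z : cd_convex A ->
  (forall y, cd_dist p y < rho -> A y) -> (forall y, cd_dist q y < rho -> A y) ->
  0 <= s <= 1 -> cd_dist (cd_seg p q s) z < rho -> A z.
Proof.
move=> cA Hp Hq Hs Hz.
pose w := cd_sub z (cd_seg p q s).
have Hw x : cd_dist x (cd_add x w) < rho.
  apply: Rle_lt_trans Hz; apply: Req_le; rewrite /cd_dist cd_norm_sub_sym.
  by rewrite (cd_norm_sub_sym (cd_seg p q s)) /w; congr cd_norm; cd_ring.
have -> : z = cd_seg (cd_add p w) (cd_add q w) s by rewrite /w /cd_seg; cd_ring.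
by apply: cA => //; [apply: Hp | apply: Hq]; exact: Hw.
Qed.

(** By convexity one radius serves all points of the segment, which is cut into steps shorter than
    it; each step is a link in a ball. *)
Lemma nchain_exists {d} (A : cd_set d) p q : cd_open A -> cd_convex A -> A p -> A q ->
  exists r, nchain A p q r.
Proof.
move=> oA cA Ap Aq.
have [r1 [r10 H1]] := oA p Ap; have [r2 [r20 H2]] := oA q Aq.
pose rho := Rmin r1 r2.
have rho0 : 0 < rho by apply: Rmin_pos.
have {}H1 y : cd_dist p y < rho -> A y by move=> H; apply: H1; have := Rmin_l r1 r2; rewrite -/rho; lra.
have {}H2 y : cd_dist q y < rho -> A y by move=> H; apply: H2; have := Rmin_r r1 r2; rewrite -/rho; lra.
have D0 : 0 <= cd_dist p q := cd_norm_ge0 _.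
have [n Hn] := INR_unbounded (cd_dist p q / rho).
have n0 : 0 < INR n by apply: Rle_lt_trans Hn; apply: Rdiv_le_0_compat.
have step : cd_dist p q / INR n < rho.
  apply: (Rmult_lt_reg_r (INR n)) => //.
  rewrite /Rdiv Rmult_assoc Rinv_l ?Rmult_1_r; last lra.
  have -> : cd_dist p q = cd_dist p q / rho * rho by field; lra.
  by rewrite (Rmult_comm rho); apply: Rmult_lt_compat_r.
suff H k : (k <= n)%N -> exists r, nchain A p (cd_seg p q (INR k / INR n)) r.
  have [r] := H n (leqnn n); have -> : INR n / INR n = 1 by field; lra.
  have -> : cd_seg p q 1 = q by rewrite /cd_seg; cd_ring.
  by exists r.
elim: k => [_|k IH Hk].
  exists 0; rewrite (_ : cd_seg p q _ = p); first exact: nchain_nil.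
  rewrite /cd_seg /= (_ : 0 / INR n = 0); [cd_ring | field; lra].
have [r Hr] := IH (ltnW Hk).
have kn : INR k.+1 <= INR n by apply: le_INR; apply/leP.
have k0 := pos_INR k.
have B : forall y, cd_dist (cd_seg p q (INR k / INR n)) y < rho -> A y.
  move=> y; apply: ball_seg => //; split; first exact: Rdiv_le_0_compat.
  apply: (Rmult_le_reg_r (INR n)) => //; rewrite /Rdiv Rmult_assoc Rinv_l; last lra.
  rewrite S_INR in kn; lra.
have Ed : cd_dist (cd_seg p q (INR k / INR n)) (cd_seg p q (INR k.+1 / INR n)) = cd_dist p q / INR n.
  rewrite /cd_dist.
  have -> : cd_sub (cd_seg p q (INR k / INR n)) (cd_seg p q (INR k.+1 / INR n)) =
    cd_scal (RtoC (/ INR n)) (cd_sub p q).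
    have -> : INR k.+1 / INR n = INR k / INR n + / INR n by rewrite S_INR; field; lra.
    by rewrite /cd_seg; cd_ring.
  rewrite cd_norm_scal Cmod_R Rabs_pos_eq; last by apply: Rlt_le; exact: Rinv_0_lt_compat.
  by rewrite Rmult_comm.
exists (r + psi (cd_dist (cd_seg p q (INR k / INR n)) (cd_seg p q (INR k.+1 / INR n)) / rho)).
apply: nchain_append Hr _; apply: nchain_link; apply: link_ball => //.
by rewrite Ed.
Qed.

(** The functional maps each disc into a half plane, where Schwarz' lemma gives the factor
    [(1 + t) / (1 - t) = exp (2 * psi t)]; along the chain the factors multiply. *)
Lemma nchain_half_plane {d} (A : cd_set d) y u p q r :
  (forall z, A z -> Re (herm (cd_sub z y) u) < 0) -> nchain A p q r ->
  Cmod (herm (cd_sub q y) u) <= Cmod (herm (cd_sub p y) u) * exp (2 * r).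
Proof.
move=> neg; elim=> {p q r} [p | p x q t r [Ht [g [[g1 g2] [E0 Et]]]] _ IH].
  by rewrite Rmult_0_r exp_0; lra.
apply: Rle_trans IH _.
rewrite Rmult_plus_distr_l exp_plus -Rmult_assoc.
apply: Rmult_le_compat_r; first by apply: Rlt_le; exact: exp_pos.
have tt : Cmod (RtoC t) = t by rewrite Cmod_R Rabs_pos_eq; lra.
have := half_plane_schwarz (fun z => herm (cd_sub (g z) y) u) _ _ (RtoC t).
rewrite Et E0 tt exp_psi //; apply; last by case: Ht.
- move=> z Hz; rewrite /herm; apply: cdiff_sum => i.
  apply: cdiff_mult; last exact: cdiff_const.
  by rewrite /cd_sub; apply: cdiff_plus; [exact: g1 | exact: cdiff_const].
- by move=> z Hz; apply: neg; exact: g2.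
Qed.

(** * Affine images and local Hausdorff limits *)

Lemma affine_herm {d} (F : Cd d -> Cd d) : is_cd_affine F ->
  exists (m : 'I_d -> Cd d) b, forall z i, F z i = (herm z (m i) + b i)%C.
Proof.
move=> [M [b HF]]; exists (fun i j => Cconj (M i j)), b => z i; rewrite HF; congr Cplus.
apply: eq_bigr => j _.
have -> : Cconj (Cconj (M i j)) = M i j by apply: Ceq; rewrite !(Re_conj, Im_conj); ring.
ring.
Qed.

Lemma herm_bound {d} (x u : Cd d) :
  Cmod (herm x u) <= cd_norm x * \big[Rplus/0]_(i < d) Cmod (u i).
Proof.
rewrite /herm; elim: (index_enum _) => [|i s IH].
  by rewrite !big_nil Cmod_0 Rmult_0_r; exact: Rle_refl.
rewrite !big_cons Rmult_plus_distr_l.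
apply: Rle_trans (Cmod_triangle _ _) _; apply: Rplus_le_compat; last exact: IH.
rewrite Cmod_mult Cmod_conj; apply: Rmult_le_compat_r; [exact: Cmod_ge_0 | exact: cd_norm_comp].
Qed.

Lemma Rsum_le_mul {I} (s : seq I) (F G : I -> R) c : (forall i, F i <= c * G i) ->
  \big[Rplus/0]_(i <- s) F i <= c * \big[Rplus/0]_(i <- s) G i.
Proof.
move=> H; elim: s => [|i s IH]; first by rewrite !big_nil Rmult_0_r; exact: Rle_refl.
by rewrite !big_cons Rmult_plus_distr_l; apply: Rplus_le_compat.
Qed.

Lemma affine_lipschitz {d} (F : Cd d -> Cd d) : is_cd_affine F ->
  exists K, 0 <= K /\ forall x y, cd_dist (F x) (F y) <= K * cd_dist x y.
Proof.
move=> /affine_herm [m [b HF]].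
exists (\big[Rplus/0]_(i < d) \big[Rplus/0]_(j < d) Cmod (m i j)); split.
  by apply: Rsum_ge0 => i; apply: Rsum_ge0 => j; exact: Cmod_ge_0.
move=> x y; apply: Rle_trans (cd_norm_le_sum _) _.
rewrite Rmult_comm; apply: Rsum_le_mul => i; rewrite {1}/cd_sub !HF.
have -> : (herm x (m i) + b i - (herm y (m i) + b i) = herm (cd_sub x y) (m i))%C by rewrite herm_sub; ring.
exact: herm_bound.
Qed.

Lemma affine_seg {d} (F : Cd d -> Cd d) x y t : is_cd_affine F ->
  F (cd_seg x y t) = cd_seg (F x) (F y) t.
Proof.
move=> /affine_herm [m [b HF]]; apply: cd_ext => i.
rewrite /cd_seg HF herm_add herm_scal herm_sub /cd_add /cd_scal /cd_sub !HF; ring.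
Qed.

(** [g j] is the preimage of [e j + b], so [M] sends it to [e j]: these vectors are the columns of
    the inverse matrix. *)
Lemma affine_inverse {d} (F G : Cd d -> Cd d) : is_cd_affine F ->
  (forall z, G (F z) = z) -> (forall z, F (G z) = z) -> is_cd_affine G.
Proof.
move=> [M [b HF]] GF FG.
pose e (j : 'I_d) : Cd d := fun i => if i == j then RtoC 1 else RtoC 0.
pose g j := G (cd_add (e j) b).
have Hg i j : \big[Cplus/RtoC 0]_(k < d) Cmult (M i k) (g j k) = e j i.
  have := f_equal (fun z => z i) (FG (cd_add (e j) b)); rewrite HF /cd_add -/(g j) => H.
  set S := bigop _ _ _ in H *.
  have -> : S = (S + b i - b i)%C by ring.
  rewrite H; ring.
pose c i := (- (1) * \big[Cplus/RtoC 0]_(j < d) Cmult (g j i) (b j))%C.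
exists (fun i j => g j i), c => w i.
pose x : Cd d := fun i => \big[Cplus/RtoC 0]_(j < d) Cmult (w j - b j)%C (g j i).
have Fx : F x = w.
  apply: cd_ext => k; rewrite HF.
  have -> : \big[Cplus/RtoC 0]_(j < d) Cmult (M k j) (x j) =
     \big[Cplus/RtoC 0]_(j < d) Cmult (w j - b j)%C (e j k).
    transitivity (\big[Cplus/RtoC 0]_(j < d) \big[Cplus/RtoC 0]_(l < d)
       (M k j * ((w l - b l) * g l j))%C).
      by apply: eq_bigr => j _; rewrite /x Csum_mulr.
    rewrite exchange_big; apply: eq_bigr => l _; rewrite -Hg Csum_mulr.
    by apply: eq_bigr => j _; ring.
  rewrite (bigD1 k) //= big1 => [|j jk]; first by rewrite /e eqxx; ring.
  by rewrite /e eq_sym (negbTE jk); ring.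
rewrite -{1}Fx GF /x /c Csum_mulr -big_split; apply: eq_bigr => j _ /=; ring.
Qed.

Lemma image_open {d} (F : Cd d -> Cd d) (A : cd_set d) : Aff F -> cd_open A -> cd_open (cd_image F A).
Proof.
move=> [aF [G [GF FG]]] oA _ [z [Az ->]].
have [K [K0 HK]] := affine_lipschitz G (affine_inverse F G aF GF FG).
have [rho [rho0 Hrho]] := oA z Az.
exists (rho / (K + 1)); split; first by apply: Rdiv_lt_0_compat; lra.
move=> y Hy; exists (G y); split; last by rewrite FG.
apply: Hrho; rewrite -{1}(GF z); apply: Rle_lt_trans (HK _ _) _.
have D0 : 0 <= cd_dist (F z) y := cd_norm_ge0 _.
have -> : rho = (K + 1) * (rho / (K + 1)) by field; lra.
nra.
Qed.

Lemma image_convex {d} (F : Cd d -> Cd d) (A : cd_set d) : Aff F -> cd_convex A -> cd_convex (cd_image F A).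
Proof.
move=> [aF _] cA _ _ [x [Ax ->]] [y [Ay ->]] t Ht.
exists (cd_seg x y t); split; first exact: cA.
by rewrite affine_seg.
Qed.

Lemma kob_dist_image {d} (F : Cd d -> Cd d) (A : cd_set d) p q : Aff F ->
  kob_dist (cd_image F A) (F p) (F q) = kob_dist A p q.
Proof.
move=> [aF [G [GF FG]]]; rewrite /kob_dist; congr real; apply: Glb_Rbar_eqset => r.
rewrite !kob_chain_nchain; split=> H.
  rewrite -(GF p) -(GF q); apply: nchain_affine H; first exact: (affine_inverse F).
  by move=> _ [z [Az ->]]; rewrite GF.
by apply: nchain_affine H => // z Az; exists z.
Qed.

Lemma hausdorff_dist_lt {d} (K L : cd_set d) (eps : R) : Rbar_lt (hausdorff_dist K L) eps ->
  exists e, 0 <= e < eps /\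
    (forall x, K x -> cd_nbhd L e x) /\ (forall x, L x -> cd_nbhd K e x).
Proof.
move=> H; apply: NNPP => nH.
have [_ H2] := Glb_Rbar_correct (fun eps => 0 <= eps /\
    (forall x, K x -> cd_nbhd L eps x) /\ (forall x, L x -> cd_nbhd K eps x)).
apply: (Rbar_lt_not_le _ _ H); apply: H2 => e [e0 He] /=.
by apply: Rnot_lt_le => K1; apply: nH; exists e.
Qed.

(** * Eventual inclusions and convergence of the Kobayashi distances *)

Section LocalLimit.
Variables (d : nat) (An : nat -> cd_set d) (A : cd_set d).
Hypothesis cvgA : local_hausdorff_cvg An A.
Hypotheses (oAn : forall n, cd_open (An n)) (cAn : forall n, cd_convex (An n)).
Hypotheses (oA : cd_open A) (cA : cd_convex A) (pA : C_proper A).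

(** Each [z] is within [rho * (1 - mu)] of the closure of [A], an error that the ball around [p]
    absorbs by [seg_shift]. *)
Lemma dilation_into_limit p R0 mu : A p -> 0 <= mu < 1 ->
  exists N, forall n, (N <= n)%N -> forall z, An n z -> cd_norm z <= R0 -> A (cd_seg p z mu).
Proof.
move=> Ap Hmu; have [rho [rho0 Hrho]] := oA p Ap.
have e0 : 0 < rho * (1 - mu) by apply: Rmult_lt_0_compat; lra.
(* [R0] may fail to be positive, as the convergence requires. *)
have [N HN] := cvgA (Rmax R0 1) ltac:(have := Rmax_r R0 1; lra) _ e0.
exists N => n /HN /hausdorff_dist_lt [e [He [H1 _]]] z Az Hz.
have [|z' [[Cz' _] Hz']] := H1 z.
  by split; [exact: cd_closure_sub | apply: Rle_trans Hz (Rmax_l _ _)].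
have [p' [Ap' ->]] := seg_shift A p z z' mu rho Hrho Hmu ltac:(lra).
exact: segment_interior.
Qed.

(** Hausdorff convergence only puts points of [An n] near those of [A]. Convexity fills the gaps: a
    half space that misses [An n] would keep it away from a point near [x]. *)
Lemma ball_eventually x : A x ->
  exists rho N, 0 < rho /\ forall n, (N <= n)%N -> forall y, cd_dist x y < rho -> An n y.
Proof.
move=> Ax; have [rho2 [rho20 Hrho]] := oA x Ax.
pose rho := rho2 / 2.
have rho0 : 0 < rho by rewrite /rho; lra.
have X0 := cd_norm_ge0 x.
have [N HN] := cvgA (cd_norm x + rho2) ltac:(lra) (rho / 2) ltac:(lra).
exists rho, N; split => // n /HN /hausdorff_dist_lt [e [He [_ H2]]].
have near w : cd_dist x w < rho2 -> exists z, An n z /\ cd_dist w z < rho / 2.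
  move=> Hw; have [|z [[Cz _] Hz]] := H2 w.
    split; first by apply: cd_closure_sub; exact: Hrho.
    by have := cd_norm_le_dist w x; rewrite cd_dist_sym /cd_closed_ball; lra.
  have [z' [Az' Hz']] := Cz (rho / 2 - e) ltac:(lra).
  by exists z'; split => //; have := cd_dist_triangle w z z'; lra.
have [a [Aa _]] := near x ltac:(rewrite cd_dist_refl; lra).
have cl y : cd_dist x y < rho -> cd_closure (An n) y.
  move=> Hy; apply: NNPP => nC.
  have [u [u0 Hu]] := strict_separation (An n) y (oAn n) (cAn n) (ex_intro _ a Aa) nC.
  (* [w] is [y] moved by [rho / 2] away from [An n]; every point of [An n] is farther than [rho / 2]
     from it, yet [near] applies because [rho] is only half of [rho2]. *)
  pose w := cd_add y (cd_scal (RtoC (rho / 2 / cd_norm u)) u).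
  have c0 : 0 < rho / 2 / cd_norm u by apply: Rdiv_lt_0_compat; lra.
  have Dw : cd_dist y w = rho / 2.
    rewrite /cd_dist cd_norm_sub_sym (_ : cd_sub w y = cd_scal (RtoC (rho / 2 / cd_norm u)) u).
      by rewrite cd_norm_scal Cmod_R Rabs_pos_eq; [field; lra | lra].
    by rewrite /w; cd_ring.
  have [|z [Az Hz]] := near w.
    by have := cd_dist_triangle x y w; rewrite Dw /rho; rewrite /rho in Hy; lra.
  have := Hu z Az.
  have Ew : Re (herm (cd_sub w y) u) = rho / 2 * cd_norm u.
    rewrite (_ : cd_sub w y = cd_scal (RtoC (rho / 2 / cd_norm u)) u); last by rewrite /w; cd_ring.
    rewrite herm_scal Re_mult -cd_norm_sqr (_ : Re (RtoC _) = rho / 2 / cd_norm u) //.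
    rewrite (_ : Im (RtoC _) = 0) //; field; lra.
  have := cauchy_schwarz (cd_sub w z) u.
  have -> : cd_sub w z = cd_sub (cd_sub w y) (cd_sub z y) by cd_ring.
  rewrite herm_sub Re_minus Ew.
  have -> : cd_sub (cd_sub w y) (cd_sub z y) = cd_sub w z by cd_ring.
  rewrite /cd_dist in Hz; nra.
move=> y Hy; apply: (interior_closure _ a y (rho - cd_dist x y)) => //; first lra.
by move=> z Hz; apply: cl; have := cd_dist_triangle x y z; lra.
Qed.

(* The functional separating [An n] from a point [xi] of the complex line
   through [p] and [y], at bounded distance from [p], maps [An n] into a half
   plane and multiplies distances along this line by a constant. *)
Lemma kob_balls_bounded p T : A p ->
  exists R0 N, forall n, (N <= n)%N -> forall y r, nchain (An n) p y r -> r <= T -> cd_norm y <= R0.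
Proof.
move=> Ap.
have [R0 [R00 HR]] := C_proper_radius A p oA cA pA Ap.
have [N1 H1] := dilation_into_limit p (cd_norm p + 2 * R0) (/ 2) Ap ltac:(lra).
have [rho [N2 [rho0 H2]]] := ball_eventually p Ap.
(* [4 * R0] bounds the distance from [p] to the point [xi], reached by doubling twice; the estimate
   obtained is [|D - 4 l| <= 4 |l| exp (2 r)]. *)
exists (cd_norm p + 4 * R0 * (1 + exp (2 * T))), (maxn N1 N2) => n.
rewrite geq_max => /andP[/H1 {}H1 /H2 {}H2] y r Hr rT.
have Anp : An n p by apply: H2; rewrite cd_dist_refl.
have E0 := exp_pos (2 * T).
have := cd_norm_le_dist y p; rewrite cd_dist_sym.
set D := cd_dist p y; have D0 : 0 <= D := cd_norm_ge0 _.
suff : D <= 4 * R0 * (1 + exp (2 * T)) by lra.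
case: (Req_dec D 0) => [-> | ND]; first by apply: Rmult_le_pos; lra.
pose v := cd_scal (RtoC (/ D)) (cd_sub y p).
have v1 : cd_norm v = 1.
  rewrite /v cd_norm_scal cd_norm_sub_sym -/(cd_dist p y) -/D Cmod_R Rabs_pos_eq; first by field.
  by apply: Rlt_le; apply: Rinv_0_lt_compat; lra.
have [l [Hl nA]] := HR v v1.
have half (w : C) : cd_seg p (cd_add p (cd_scal (2 * w)%C v)) (/ 2) = cd_add p (cd_scal w v).
  rewrite /cd_seg; apply: cd_ext => i; rewrite /cd_add /cd_sub /cd_scal.
  rewrite RtoC_inv; last lra.
  field.
(* The dilation of ratio [/ 2] would carry this point to [p + l v], which is outside [A]; the radius
   in [H1] was chosen to include it. *)
have n1 : ~ An n (cd_add p (cd_scal (2 * l)%C v)).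
  move=> K; apply: nA; rewrite -half; apply: H1 K _.
  apply: Rle_trans (cd_norm_triangle _ _) _.
  rewrite cd_norm_scal v1 Cmod_mult Cmod_R Rabs_pos_eq; lra.
(* A second doubling strengthens exclusion from the set to exclusion from its closure. *)
pose xi := cd_add p (cd_scal (2 * (2 * l))%C v).
have n2 : ~ cd_closure (An n) xi.
  by move=> K; apply: n1; rewrite -half; apply: segment_interior => //; lra.
have [u [u0 Hu]] := strict_separation (An n) xi (oAn n) (cAn n) (ex_intro _ p Anp) n2.
have neg z : An n z -> Re (herm (cd_sub z xi) u) < 0.
  move=> /Hu H.
  have : 0 < cd_norm u * cd_norm u by apply: Rmult_lt_0_compat.
  lra.
have := nchain_half_plane (An n) xi u p y r neg Hr.
set c := herm v u.
have Ep : herm (cd_sub p xi) u = (- (4) * l * c)%C.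
  have -> : cd_sub p xi = cd_scal (- (4) * l)%C v by rewrite /xi; cd_ring.
  by rewrite herm_scal.
have Ey : herm (cd_sub y xi) u = ((RtoC D - 4 * l) * c)%C.
  have -> : cd_sub y xi = cd_scal (RtoC D - 4 * l)%C v.
    rewrite /xi; apply: cd_ext => i; rewrite /v /cd_sub /cd_scal /cd_add.
    rewrite RtoC_inv //; field.
    by move=> /(f_equal Re) /=.
  by rewrite herm_scal.
(* Otherwise the functional would vanish at [p], where it is negative. *)
have c0 : 0 < Cmod c.
  apply/Cmod_gt_0 => Z; have := neg p Anp; rewrite Ep Z Cmult_0_r /=; lra.
rewrite Ep Ey !Cmod_mult => H.
have {}H : Cmod (RtoC D - 4 * l)%C <= Cmod (- (4))%C * Cmod l * exp (2 * r).
  by apply: (Rmult_le_reg_r (Cmod c)) => //; lra.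
have F4 : Cmod (- (4))%C = 4 by rewrite Cmod_opp Cmod_R Rabs_pos_eq; lra.
have G4 : Cmod (4 * l)%C = 4 * Cmod l by rewrite Cmod_mult Cmod_R Rabs_pos_eq; lra.
have := Cmod_le_dist (RtoC D) (4 * l)%C; rewrite G4 Cmod_R Rabs_pos_eq // => B.
have er : exp (2 * r) <= exp (2 * T).
  by case: rT => [K | ->]; [apply: Rlt_le; apply: exp_increasing; lra | lra].
have l0 := Cmod_ge_0 l; have er0 := exp_pos (2 * r).
have : Cmod l * exp (2 * r) <= R0 * exp (2 * T) by apply: Rmult_le_compat; lra.
rewrite F4 in H; lra.
Qed.

(** Parameters of points escaping from [An n] for arbitrarily large [n] would accumulate at some
    [l], and [An n] eventually contains a whole ball around [g l]. *)
Lemma disc_eventually g s : disc_map A g -> s < 1 ->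
  exists N, forall n, (N <= n)%N -> forall z, Cmod z <= s -> An n (g z).
Proof.
move=> [dg Ag] s1; apply: NNPP => nH.
have Hn k : exists nz : nat * C, (k <= nz.1)%N /\ Cmod nz.2 <= s /\ ~ An nz.1 (g nz.2).
  apply: NNPP => H; apply: nH; exists k => n Hn z Hz; apply: NNPP => K.
  by apply: H; exists (n, z).
pose w k := proj1_sig (constructive_indefinite_description _ (Hn k)).
have Hw k : (k <= (w k).1)%N /\ Cmod (w k).2 <= s /\ ~ An (w k).1 (g (w k).2).
  by rewrite /w; case: constructive_indefinite_description.
have [phi [l [P L]]] := complex_cluster (fun k => (w k).2) s (fun k => (Hw k).2.1).
have Hl : Cmod l <= s := Cmod_ctendsto_le _ _ _ L (fun k => (Hw _).2.1).
have Lg : cd_tendsto (fun k => g (w (phi k)).2) (g l).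
  apply: cd_tendsto_comp => i.
  by apply: (ccont_ctendsto (fun z => g z i)) L; apply: cdiff_ccont; apply: dg; lra.
have [rho [N [rho0 H]]] := ball_eventually (g l) (Ag l ltac:(lra)).
have [N2 H2] := Lg rho rho0.
have K1 := H2 (maxn N N2) (leq_maxr _ _).
apply: (Hw (phi (maxn N N2))).2.2; apply: H; last by rewrite cd_dist_sym.
apply: leq_trans (leq_maxl N N2) _; apply: leq_trans (P _) _; exact: (Hw _).1.
Qed.

Lemma shrink_factor T eta : T < 1 -> 0 < eta -> exists s, T < s < 1 /\ 2 * (1 - s) / (s - T) <= eta.
Proof.
(* With [s = 1 - k], the half keeps [s - T >= (1 - T) / 2], and the other entry makes
   [2 * (1 - s) <= (1 - T) * eta / 2]. *)
move=> T1 e0; pose k := (1 - T) * Rmin (/ 2) (eta / 4).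
have m0 : 0 < Rmin (/ 2) (eta / 4) by apply: Rmin_pos; lra.
have L1 := Rmin_l (/ 2) (eta / 4); have L2 := Rmin_r (/ 2) (eta / 4).
have k0 : 0 < k by apply: Rmult_lt_0_compat; lra.
have k1 : k <= (1 - T) * / 2 by apply: Rmult_le_compat_l; lra.
have k2 : k <= (1 - T) * (eta / 4) by apply: Rmult_le_compat_l; lra.
exists (1 - k); split; first lra.
apply: (Rmult_le_reg_r (1 - k - T)); first lra.
rewrite /Rdiv Rmult_assoc Rinv_l; last lra.
have : (1 - T) * eta / 2 <= eta * (1 - k - T) by nra.
lra.
Qed.

Lemma disc_map_shrink (B : cd_set d) g s : 0 < s < 1 ->
  (forall i z, Cmod z < 1 -> cdiff (fun w => g w i) z) ->
  (forall z, Cmod z < s -> B (g z)) -> disc_map B (fun z => g (RtoC s * z)%C).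
Proof.
move=> Hs dg Bg.
have E z : Cmod (RtoC s * z)%C = s * Cmod z by rewrite Cmod_mult Cmod_R Rabs_pos_eq; lra.
split=> [i z Hz | z Hz].
  apply: (cdiff_comp (fun w => g w i) (fun z => RtoC s * z)%C).
    by apply: cdiff_mult; [exact: cdiff_const | exact: cdiff_id].
  by apply: dg; rewrite E; have := Cmod_ge_0 z; nra.
by apply: Bg; rewrite E; have := Cmod_ge_0 z; nra.
Qed.

Lemma shrink_endpoint s t : 0 < s -> (RtoC s * RtoC (t / s))%C = RtoC t.
Proof. by move=> s0; rewrite -RtoC_mult; congr RtoC; field; lra. Qed.

(** The chain is fixed here, so each of its finitely many links may have its own shrinking factor
    and share of the error. *)
Lemma nchain_eventually p q r e : nchain A p q r -> 0 < e ->
  exists N, forall n, (N <= n)%N -> exists r', nchain (An n) p q r' /\ r' <= r + e.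
Proof.
move=> H; elim: H e => {p q r} [p | p x q t r [Ht [g [Ag [E0 Et]]]] _ IH] e e0.
  by exists 0%N => n _; exists 0; split; [exact: nchain_nil | lra].
have [N1 H1] := IH (e / 2) ltac:(lra).
have P0 := psi_ge0 t Ht.
have [s [Hs Hs2]] := shrink_factor t (e / 2 / (psi t + 1)) ltac:(lra) ltac:(apply: Rdiv_lt_0_compat; lra).
have [N2 H2] := disc_eventually g s Ag ltac:(lra).
exists (maxn N1 N2) => n; rewrite geq_max => /andP[/H1 [r' [C1 B1]] /H2 {}H2].
have [t1 t2] := psi_shrink t t s ltac:(lra) Hs.
exists (psi (t / s) + r'); split.
  apply: nchain_cons C1; split; first by split => //; apply: Rdiv_le_0_compat; lra.
  exists (fun z => g (RtoC s * z)%C); split; last by rewrite Cmult_0_r shrink_endpoint //; lra.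
  by apply: disc_map_shrink; [lra | case: Ag | move=> z Hz; apply: H2; lra].
have : psi t * (2 * (1 - s) / (s - t)) <= (psi t + 1) * (e / 2 / (psi t + 1)).
  apply: Rmult_le_compat; try lra.
  by apply: Rdiv_le_0_compat; lra.
have -> : (psi t + 1) * (e / 2 / (psi t + 1)) = e / 2 by field; lra.
lra.
Qed.

Lemma psi_le_double s : 0 <= s <= / 2 -> psi s <= 2 * s.
Proof.
move=> Hs; have := ln_le_sub1 _ (psi_arg_gt0 s ltac:(lra)); rewrite /psi.
have -> : (1 + s) / (1 - s) - 1 = 2 * (s / (1 - s)) by field; lra.
have : s / (1 - s) <= 2 * s.
  apply: (Rmult_le_reg_r (1 - s)); first lra.
  by rewrite /Rdiv Rmult_assoc Rinv_l; nra.
lra.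
Qed.

(* Discs of a chain of bounded length, restricted to a smaller concentric disc,
   stay in a Kobayashi ball of [An n], hence in a fixed Euclidean ball; there
   [An n] is carried into [A] by a dilation of ratio [mu] close to 1. *)
Lemma nchain_into_limit p q r0 e : A p -> A q -> 0 <= r0 -> 0 < e ->
  exists N, forall n, (N <= n)%N -> forall r, nchain (An n) p q r -> r <= r0 ->
    kob_dist A p q <= r + e.
Proof.
move=> Ap Aq r00 e0.
have [rho [rho0 Hrho]] := oA q Aq.
(* A relative error [eta] on a length at most [r0] costs at most [e / 2]; the other half is kept for
   the link that ends at [q]. *)
pose eta := e / (2 * (r0 + 1)).
have eta0 : 0 < eta by apply: Rdiv_lt_0_compat; lra.
pose T := 1 - exp (- (2 * r0)).
have T1 : T < 1 by rewrite /T; have := exp_pos (- (2 * r0)); lra.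
have T0 : 0 <= T.
  rewrite /T; have : exp (- (2 * r0)) <= exp 0; last by rewrite exp_0; lra.
  by case: r00 => [K | <-]; [apply: Rlt_le; apply: exp_increasing; lra | rewrite Rmult_0_r Ropp_0; lra].
have [s [Hs Hs2]] := shrink_factor T eta T1 eta0.
(* Each link starts within [r0] of [p], and the points of its disc of radius [s] are within [psi s]
   of its start. *)
have [R0 [N1 H1]] := kob_balls_bounded p (r0 + psi s) Ap.
set D := cd_dist p q; have D0 : 0 <= D := cd_norm_ge0 _.
pose k := Rmin (/ 4) (e / 8).
have k0 : 0 < k by apply: Rmin_pos; lra.
have k1 : k <= / 4 := Rmin_l _ _; have k2 : k <= e / 8 := Rmin_r _ _.
(* The dilation moves [q] by [th * D <= k * rho]. In a ball of radius [rho / 2] the correcting link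
   has parameter at most [2 * k <= / 2], hence length at most [4 * k <= e / 2]. *)
pose th := Rmin 1 (k * (rho / (D + 1))).
have th0 : 0 < th by apply: Rmin_pos; [lra | apply: Rmult_lt_0_compat => //; apply: Rdiv_lt_0_compat; lra].
have th1 : th <= 1 := Rmin_l _ _; have th2 : th <= k * (rho / (D + 1)) := Rmin_r _ _.
pose mu := 1 - th.
have Hmu : 0 <= mu < 1 by rewrite /mu; lra.
have [N2 H2] := dilation_into_limit p R0 mu Ap Hmu.
exists (maxn N1 N2) => n; rewrite geq_max => /andP[/H1 {}H1 /H2 {}H2].
(* The chain of length [r1] already travelled from [p] is carried along, since the Euclidean bound
   on the discs refers to Kobayashi balls centred at [p]. *)
have main p1 q1 r : nchain (An n) p1 q1 r -> forall r1, nchain (An n) p p1 r1 -> r1 + r <= r0 ->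
    exists r', nchain A (cd_seg p p1 mu) (cd_seg p q1 mu) r' /\ r' <= r * (1 + eta).
  elim=> {p1 q1 r} [p1 | p1 x q1 t r L Hc IH] r1 C1 Hr.
    by exists 0; split; [exact: nchain_nil | lra].
  have C2 := nchain_append _ _ _ _ _ _ C1 (nchain_link _ _ _ _ L).
  have [r' [C3 B3]] := IH _ C2 ltac:(lra).
  have r10 := nchain_ge0 _ _ _ _ C1; have rr0 := nchain_ge0 _ _ _ _ Hc.
  case: L => Ht [g [Ag [E0 Et]]].
  have tT : t <= T by apply: psi_bound => //; lra.
  have [t1 t2] := psi_shrink t T s ltac:(lra) Hs.
  have P0 := psi_ge0 t Ht.
  exists (psi (t / s) + r'); split; last first.
    have : psi t * (2 * (1 - s) / (s - T)) <= psi t * eta by apply: Rmult_le_compat_l.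
    lra.
  apply: nchain_cons C3; split; first by split => //; apply: Rdiv_le_0_compat; lra.
  exists (fun z => cd_seg p (g (RtoC s * z)%C) mu); split; last first.
    by rewrite Cmult_0_r shrink_endpoint ?E0 ?Et //; lra.
  apply: (disc_map_affine (fun z => An n z /\ cd_norm z <= R0) A (fun z => cd_seg p z mu)).
  - exact: affine_dilation.
  - by move=> z [Z1 Z2]; exact: H2.
  apply: disc_map_shrink; [lra | by case: Ag |].
  move=> z Hz; split; first by apply: Ag.2; lra.
  have Lz := link_disc_point _ _ z Ag ltac:(lra); rewrite E0 in Lz.
  apply: (H1 _ _ (nchain_append _ _ _ _ _ _ C1 (nchain_link _ _ _ _ Lz))).
  have := psi_le (Cmod z) s (conj (Cmod_ge_0 z) (Rlt_le _ _ Hz)) ltac:(lra).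
  have := psi_ge0 t Ht; lra.
move=> r Hr rr0.
have [r' [C1 B1]] := main _ _ _ Hr 0 (nchain_nil _ _) ltac:(lra).
have Epp : cd_seg p p mu = p by rewrite /cd_seg; cd_ring.
rewrite Epp in C1.
set q' := cd_seg p q mu in C1.
have Dq : cd_dist q' q = th * D.
  rewrite /cd_dist.
  have -> : cd_sub q' q = cd_scal (RtoC th) (cd_sub p q).
    have -> : th = 1 - mu by rewrite /mu; lra.
    by rewrite /q' cd_segE; cd_ring.
  by rewrite cd_norm_scal Cmod_R Rabs_pos_eq //; lra.
have thD : th * D <= k * rho.
  apply: (Rle_trans _ (k * (rho / (D + 1)) * D)); first exact: Rmult_le_compat_r.
  have -> : k * (rho / (D + 1)) * D = k * rho * (D / (D + 1)) by field; lra.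
  have : D / (D + 1) <= 1 by apply: (Rmult_le_reg_r (D + 1)); [lra | rewrite /Rdiv Rmult_assoc Rinv_l; lra].
  have : 0 <= k * rho by apply: Rmult_le_pos; lra.
  nra.
have k4 : k * rho <= / 4 * rho by apply: Rmult_le_compat_r; lra.
have L : link A q' q (cd_dist q' q / (rho / 2)).
  apply: link_ball; last by rewrite Dq; lra.
  move=> y Hy; apply: Hrho; have := cd_dist_triangle q q' y; rewrite (cd_dist_sym q q') Dq; lra.
have := kob_dist_le _ _ _ _ (nchain_append _ _ _ _ _ _ C1 (nchain_link _ _ _ _ L)).
set t := cd_dist q' q / (rho / 2).
have tk : 0 <= t <= 2 * k.
  rewrite /t Dq; split; first by apply: Rdiv_le_0_compat; [apply: Rmult_le_pos | ]; lra.
  apply: (Rmult_le_reg_r (rho / 2)); first lra.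
  by rewrite /Rdiv Rmult_assoc Rinv_l; lra.
have := psi_le_double t ltac:(lra).
have r0' := nchain_ge0 _ _ _ _ Hr.
have : r * eta <= e / 2.
  have -> : e / 2 = (r0 + 1) * eta by rewrite /eta; field; lra.
  by apply: Rmult_le_compat_r; lra.
lra.
Qed.

Lemma kob_dist_cvg p q e : A p -> A q -> 0 < e ->
  exists N, forall n, (N <= n)%N -> Rabs (kob_dist (An n) p q - kob_dist A p q) <= e.
Proof.
move=> Ap Aq e0.
have [r [Cr Hr]] := kob_dist_approx A p q (e / 2) (nchain_exists A p q oA cA Ap Aq) ltac:(lra).
have [N1 H1] := nchain_eventually p q r (e / 2) Cr ltac:(lra).
have r0 := nchain_ge0 _ _ _ _ Cr.
(* The length bound [r + e] admits near-optimal chains in [An n]: the upper bound gives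
   [kob_dist (An n) p q <= r + e / 2], and [e / 2] is the slack of the choice. *)
have [N2 H2] := nchain_into_limit p q (r + e) (e / 2) Ap Aq ltac:(lra) ltac:(lra).
exists (maxn N1 N2) => n; rewrite geq_max => /andP[/H1 [r' [C1 B1]] /H2 {}H2].
have U := kob_dist_le _ _ _ _ C1.
have [r2 [C2 B2]] := kob_dist_approx (An n) p q (e / 2) (ex_intro _ _ C1) ltac:(lra).
have := H2 r2 C2 ltac:(lra).
move=> L; apply/Rabs_le_between; lra.
Qed.

End LocalLimit.

(** * The four-point condition in the limit *)

Theorem theorem1p8 (d : nat) (Omega Omega_hat : Cd d -> Prop) :
  cd_open Omega -> cd_convex Omega -> C_proper Omega ->
  gromov_hyperbolic Omega (kob_dist Omega) ->
  cd_open Omega_hat -> cd_convex Omega_hat -> C_proper Omega_hat ->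
  (exists An : nat -> Cd d -> Cd d,
     (forall n, Aff (An n)) /\
     local_hausdorff_cvg (fun n => cd_image (An n) Omega) Omega_hat) ->
  gromov_hyperbolic Omega_hat (kob_dist Omega_hat).
Proof.
move=> oO cO _ [delta [delta0 hyp]] oH cH pH [F [aF cvg]].
pose On n := cd_image (F n) Omega.
(* Membership of the points in [On n] is recorded as well: it allows them to be pulled back to
   [Omega], where the four-point condition is known. *)
have lim p q e : Omega_hat p -> Omega_hat q -> 0 < e -> exists N, forall n, (N <= n)%N ->
    [/\ On n p, On n q & Rabs (kob_dist (On n) p q - kob_dist Omega_hat p q) <= e].
  move=> Hp Hq e0.
  have oOn n : cd_open (On n) by exact: image_open.
  have cOn n : cd_convex (On n) by exact: image_convex.
  have [N1 H1] := kob_dist_cvg d On Omega_hat cvg oOn cOn oH cH pH p q e Hp Hq e0.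
  have [r1 [N2 [r10 H2]]] := ball_eventually d On Omega_hat cvg oOn cOn oH p Hp.
  have [r2 [N3 [r20 H3]]] := ball_eventually d On Omega_hat cvg oOn cOn oH q Hq.
  exists (maxn N1 (maxn N2 N3)) => n; rewrite !geq_max => /andP[K1 /andP[K2 K3]].
  by split; [apply: (H2 n K2) | apply: (H3 n K3) | exact: H1]; rewrite cd_dist_refl.
exists delta; split => // x y z w Hx Hy Hz Hw; apply: Rle_ge.
apply: Rnot_lt_le => K.
set R1 := Rmin _ _ in K; set G0 := gromov_product _ _ _ _ in K.
(* A Gromov product is half a signed sum of three distances and moves by at most [3 * e / 2]; both
   sides together move by [3 * e], less than the assumed gap [4 * e]. *)
pose e := (R1 - delta - G0) / 4.
have e0 : 0 < e by rewrite /e; lra.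
have [N1 H1] := lim x w e Hx Hw e0.
have [N2 H2] := lim y w e Hy Hw e0.
have [N3 H3] := lim x y e Hx Hy e0.
have [N4 H4] := lim z w e Hz Hw e0.
have [N5 H5] := lim x z e Hx Hz e0.
have [N6 H6] := lim z y e Hz Hy e0.
pose n := \max_(N <- [:: N1; N2; N3; N4; N5; N6]) N.
have le N : N \in [:: N1; N2; N3; N4; N5; N6] -> (N <= n)%N.
  by move=> HN; rewrite /n (big_rem N) //= leq_maxl.
have [[x' [Ox Ex]] [w' [Ow Ew]] /Rabs_le_between D1] := H1 n (le N1 ltac:(by rewrite !inE eqxx ?orbT)).
have [[y' [Oy Ey]] _ /Rabs_le_between D2] := H2 n (le N2 ltac:(by rewrite !inE eqxx ?orbT)).
have [_ _ /Rabs_le_between D3] := H3 n (le N3 ltac:(by rewrite !inE eqxx ?orbT)).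
have [[z' [Oz Ez]] _ /Rabs_le_between D4] := H4 n (le N4 ltac:(by rewrite !inE eqxx ?orbT)).
have [_ _ /Rabs_le_between D5] := H5 n (le N5 ltac:(by rewrite !inE eqxx ?orbT)).
have [_ _ /Rabs_le_between D6] := H6 n (le N6 ltac:(by rewrite !inE eqxx ?orbT)).
have := hyp x' y' z' w' Ox Oy Oz Ow.
rewrite /gromov_product -!(kob_dist_image (F n) Omega) // -Ex -Ey -Ez -Ew -/(On n).
move: D1 D2 D3 D4 D5 D6 e0 K; rewrite /e /R1 /G0 /gromov_product.
move=> D1 D2 D3 D4 D5 D6 e0 K /Rge_le.
set P := / 2 * _; set Q := / 2 * (kob_dist (On n) z w + _ - _).
rewrite /Rmin; case: Rle_dec; rewrite /P /Q; move: K e0 D1 D2 D3 D4 D5 D6;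
  rewrite /Rmin; case: Rle_dec; lra.
Qed.
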